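(* Let $V:\mathbb{R}\to\mathbb{R}$ satisfy: $V\in C^2(\mathbb{R},\mathbb{R})$; $V(x)\ge 0$ for all $x\in\mathbb{R}$ and $V(-1)=V(1)=0$; $V(x)>0$ for all $x\in(-1,1)$; and $V''(-1)>0$, $V''(1)>0$. Let $a:\mathbb{R}\to\mathbb{R}$ be a continuous function, and for $\epsilon>0$ consider the problem $$\ddot{x}(t)=a(\epsilon t)V'(x(t)),\quad t\in\mathbb{R},\qquad x(t)\to -1 \text{ as } t\to-\infty,\quad x(t)\to 1 \text{ as } t\to+\infty. \qquad (P_\epsilon)$$ (i) Suppose $a$ is asymptotically periodic: there is a continuous periodic function $a_P:\mathbb{R}\to\mathbb{R}$ with $|a(t)-a_P(t)|\to 0$ as $|t|\to+\infty$ and $0<\inf_{s\in\mathbb{R}}a(s)\le a(t)<a_P(t)$ for all $t\in\mathbb{R}$. Or suppose $a$ is coercive: $\inf_{t\in\mathbb{R}}a(t)>0$ and $a(t)\to+\infty$ as $|t|\to+\infty$. Then for each $\epsilon>0$, problem $(P_\epsilon)$ has a solution $x\in H^1_{loc}(\mathbb{R})\cap C^2(\mathbb{R})$ with $x(t)\in(-1,1)$ for all $t\in\mathbb{R}$. (ii) Suppose $a$ is bounded and satisfies $\liminf_{|t|\to\infty}a(t)=a_\infty>\inf_{t\in\mathbb{R}}a(t)=a(0)>0$. Then there exists $\epsilon^*>0$ such that for every $\epsilon\in(0,\epsilon^* )$, problem $(P_\epsilon)$ has a solution $x\in H^1_{loc}(\mathbb{R})\cap C^2(\mathbb{R})$ with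 $x(t)\in(-1,1)$ for all $t\in\mathbb{R}$.
   Context: A solution of $(P_\epsilon)$ is called a heteroclinic solution connecting the equilibria $-1$ and $1$. *)

(* Defs.v *)
From Stdlib Require Import Reals.
From Coquelicot Require Import Coquelicot.
Open Scope R_scope.

Definition C2 (f : R -> R) : Prop :=
  (forall x, ex_derive f x) /\
  (forall x, ex_derive (Derive f) x) /\
  (forall x, continuous (Derive_n f 2) x).

Definition solves_P (V a : R -> R) (eps : R) (x : R -> R) : Prop :=
  (forall t, Derive_n x 2 t = a (eps * t) * Derive V (x t)) /\
  is_lim x m_infty (-1) /\ is_lim x p_infty 1.

Definition periodic (f : R -> R) : Prop :=
  exists T, 0 < T /\ forall t, f (t + T) = f t.

Definition inf_pos (a : R -> R) : Prop :=
  Rbar_lt (Finite 0) (Glb_Rbar (fun y => exists s, y = a s)).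

Definition asymptotically_periodic (a : R -> R) : Prop :=
  exists aP : R -> R,
    (forall t, continuous aP t) /\ periodic aP /\
    is_lim (fun t => Rabs (a t - aP t)) p_infty 0 /\
    is_lim (fun t => Rabs (a t - aP t)) m_infty 0 /\
    inf_pos a /\ (forall t, a t < aP t).

Definition coercive (a : R -> R) : Prop :=
  inf_pos a /\ is_lim a p_infty p_infty /\ is_lim a m_infty p_infty.

Definition inf_outside (a : R -> R) (r : R) : Rbar :=
  Glb_Rbar (fun y => exists t, r <= Rabs t /\ y = a t).

Definition liminf_abs (a : R -> R) : Rbar :=
  Rbar_lub (fun y => exists r, y = inf_outside a r).

(* Main.v *)
Require Import Defs.
From Stdlib Require Import Reals ZArith Lra Lia Psatz Classical IndefiniteDescription.
From Coquelicot Require Import Coquelicot.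
From mathcomp Require filter.
Open Scope R_scope.

(* Minimize the action [int x'^2/2 + a(eps t) V(x)] among curves joining -1 to 1.

   Finite kinetic energy of [x] is witnessed by a function [F] (a cumulative energy) with
   [(x t - x s)^2 <= 2 (t - s) (F t - F s)]; by Cauchy-Schwarz this is equivalent to
   [x'] being in L^2, and it passes to pointwise limits. Hence pointwise limits along an
   ultrafilter, on which curves of bounded action are equi-Hoelder, give compactness and
   lower semicontinuity. Adding a hinge to [x] changes the certificate explicitly, so
   perturbing a minimizer by tents yields the Euler-Lagrange equation in the form
   "[x] minus a second antiderivative of the force has no second differences".

   A minimizing sequence can only lose compactness if its zeros run off to infinity. In the
   coercive case that costs too much action. In the other cases, around such a zero a
   near-minimizer can be cut down to a single transition between -1 and 1 of bounded length
   without raising its action noticeably; translating that transition to where the coefficient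
   is smaller (by a multiple of the period, respectively back to 0) lowers the action by a
   definite amount, which contradicts near-minimality. *)

(** * Limits along ultrafilters *)

(** The ultrafilter lemma expresses properness as non-membership of the empty set, while
    [ProperFilter] here asks every member to be inhabited; classically the two agree. *)
Lemma ultrafilter_above {T : Type} (F : (T -> Prop) -> Prop) :
  ProperFilter F ->
  exists U : (T -> Prop) -> Prop, ProperFilter U /\
    (forall P, U P \/ U (fun p => ~ P p)) /\ (forall P, F P -> U P).
Proof.
intros [Fex [FT FI FS]].
destruct (@filter.ultraFilterLemma T F) as [U [HU HF]].
{ split.
  - intros H. destruct (Fex _ H) as [x []].
  - split; [exact FT | exact FI | exact FS]. }
exists U. pose proof (@filter.ultra_proper _ _ HU) as [U0 [UT UI US]].
split; [split|split].
- intros P HP. apply NNPP. intros N. apply U0.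
  apply US with (2 := HP). intros x Px. apply N. now exists x.
- split; [exact UT | exact UI | exact US].
- intros P. exact (filter.in_ultra_setVsetC P HU).
- exact HF.
Qed.

(** The limit is the supremum of the levels [r] that [f] reaches on a member of [U]. Slightly below
    and above that supremum, the dichotomy for [U] decides the comparison with [f]. *)
Lemma ultrafilter_bounded_lim {T : Type} (U : (T -> Prop) -> Prop) (f : T -> R) (K : R) :
  ProperFilter U -> (forall P, U P \/ U (fun p => ~ P p)) ->
  U (fun p => Rabs (f p) <= K) -> exists l : R, filterlim f U (locally l).
Proof.
intros PU HU HK.
assert (FU : Filter U) by apply PU.
destruct (completeness (fun r => U (fun p => r <= f p))) as [l [Hub Hl]].
- exists K. intros r Hr.
  destruct (filter_ex _ (filter_and _ _ Hr HK)) as [p [H1 H2]].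
  apply Rabs_le_between in H2. lra.
- exists (-K). revert HK. apply filter_imp. intros p H.
  apply Rabs_le_between in H. lra.
- exists l. apply filterlim_locally. intros eps.
  assert (H1 : U (fun p => l - eps < f p)).
  { destruct (HU (fun p => l - eps < f p)) as [H|H]; [exact H|exfalso].
    assert (l <= l - eps); [|destruct eps; simpl in *; lra].
    apply Hl. intros r Hr.
    destruct (filter_ex _ (filter_and _ _ Hr H)) as [p [H1 H2]]. lra. }
  assert (H2 : U (fun p => f p < l + eps)).
  { destruct (HU (fun p => f p < l + eps)) as [H|H]; [exact H|exfalso].
    assert (l + eps <= l); [|destruct eps; simpl in *; lra].
    apply Hub. revert H. apply filter_imp. intros p Hp. lra. }
  generalize (filter_and _ _ H1 H2). apply filter_imp. intros p [A B].
  unfold ball; simpl; unfold AbsRing_ball, abs, minus, plus, opp; simpl.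
  apply Rabs_def1; lra.
Qed.

(** * Kinetic energy certificates and the action *)

Definition Kin (x F : R -> R) : Prop :=
  forall s t, s < t -> (x t - x s) ^ 2 <= 2 * (t - s) * (F t - F s).

Lemma Kin_glue (x F : R -> R) (p : R) :
  (forall s t, s < t <= p -> (x t - x s) ^ 2 <= 2 * (t - s) * (F t - F s)) ->
  (forall s t, p <= s < t -> (x t - x s) ^ 2 <= 2 * (t - s) * (F t - F s)) ->
  Kin x F.
Proof.
intros H1 H2 s t st.
destruct (Rle_lt_dec t p) as [tp|tp]; [apply H1; lra|].
destruct (Rle_lt_dec p s) as [ps|ps]; [apply H2; lra|].
specialize (H1 s p ltac:(lra)). specialize (H2 p t ltac:(lra)).
(* Cauchy-Schwarz: (A + B)^2 <= (h + k) (A^2/h + B^2/k) *)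
set (A := x p - x s) in *. set (B := x t - x p) in *.
set (h := p - s) in *. set (k := t - p) in *.
replace (x t - x s) with (A + B) by (unfold A, B; ring).
replace (t - s) with (h + k) by (unfold h, k; ring).
replace (F t - F s) with ((F p - F s) + (F t - F p)) by ring.
set (f := F p - F s) in *. set (g := F t - F p) in *.
assert (hp : 0 < h) by (unfold h; lra). assert (kp : 0 < k) by (unfold k; lra).
clearbody A B h k f g.
(* After clearing denominators, the defect is exactly [(k * A - h * B) ^ 2]. *)
apply Rmult_le_reg_l with (h * k); [nra|].
assert (k * (h + k) * A ^ 2 <= k * (h + k) * (2 * h * f)) by (apply Rmult_le_compat_l; nra).
assert (h * (h + k) * B ^ 2 <= h * (h + k) * (2 * k * g)) by (apply Rmult_le_compat_l; nra).
pose proof (pow2_ge_0 (k * A - h * B)). nra.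
Qed.

Lemma Kin_mono (x F : R -> R) : Kin x F -> forall s t, s <= t -> F s <= F t.
Proof.
intros H s t [st| ->]; [|lra].
specialize (H s t st). pose proof (pow2_ge_0 (x t - x s)).
apply Rnot_lt_le. intros N. nra.
Qed.

Lemma Kin_const (c : R) : Kin (fun _ => c) (fun _ => 0).
Proof. intros s t st. nra. Qed.

(** The elementary kink. Tents and the linear pieces that end a curve are sums of hinges, so their
    certificates can be updated one kink at a time. *)
Definition hinge (p u : R) : R := Rmax u p - p.

Lemma hinge_l (p u : R) : u <= p -> hinge p u = 0.
Proof. intros H. unfold hinge. rewrite Rmax_right; lra. Qed.

Lemma hinge_r (p u : R) : p <= u -> hinge p u = u - p.
Proof. intros H. unfold hinge. rewrite Rmax_left; lra. Qed.

Lemma hinge_continuous (p u : R) : continuous (hinge p) u.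
Proof.
apply continuity_pt_filterlim. unfold hinge. intros eps He.
exists eps. split; [exact He|]. intros v [_ Hv].
eapply Rle_lt_trans; [|exact Hv]. simpl. unfold Rdist, Rmax.
destruct (Rle_dec v p), (Rle_dec u p); unfold Rabs;
  repeat destruct Rcase_abs; lra.
Qed.

(** For smooth [x] and [u] beyond [p], this is the integral of [((x' + mu) ^ 2 - x' ^ 2) / 2] from
    [p] to [u]; using increments of [x] avoids derivatives. *)
Definition hinge_cost (x : R -> R) (mu p u : R) : R :=
  mu * (x (Rmax u p) - x p) + mu ^ 2 / 2 * hinge p u.

Lemma hinge_cost_l (x : R -> R) (mu p u : R) : u <= p -> hinge_cost x mu p u = 0.
Proof.
intros H. unfold hinge_cost. rewrite hinge_l by exact H.
rewrite Rmax_right by exact H. ring.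
Qed.

Lemma hinge_cost_r (x : R -> R) (mu p u : R) :
  p <= u -> hinge_cost x mu p u = mu * (x u - x p) + mu ^ 2 / 2 * (u - p).
Proof.
intros H. unfold hinge_cost. rewrite hinge_r by exact H.
rewrite Rmax_left by exact H. ring.
Qed.

(* Adding an affine function changes the sum of squared increments exactly, so
   kinks cost nothing but bookkeeping. *)
Lemma Kin_hinge (x F : R -> R) (mu p : R) :
  Kin x F ->
  Kin (fun u => x u + mu * hinge p u) (fun u => F u + hinge_cost x mu p u).
Proof.
intros H. apply Kin_glue with p; intros s t st.
- rewrite !hinge_l, !hinge_cost_l by lra. specialize (H s t ltac:(lra)). lra.
- rewrite !hinge_r, !hinge_cost_r by lra. specialize (H s t ltac:(lra)). nra.
Qed.

Lemma Kin_stop (x F : R -> R) (p : R) :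
  Kin x F -> Kin (fun u => x (Rmin u p)) (fun u => F (Rmin u p)).
Proof.
intros H. apply Kin_glue with p; intros s t st.
- rewrite !Rmin_left by lra. apply H. lra.
- rewrite !Rmin_right by lra. lra.
Qed.

Lemma Kin_reverse (x F : R -> R) :
  Kin x F -> Kin (fun u => x (- u)) (fun u => - F (- u)).
Proof.
intros H s t st. specialize (H (-t) (-s) ltac:(lra)). nra.
Qed.

Lemma Kin_shift (x F : R -> R) (k : R) :
  Kin x F -> Kin (fun u => x (u + k)) (fun u => F (u + k)).
Proof.
intros H s t st. specialize (H (s + k) (t + k) ltac:(lra)).
replace (t + k - (s + k)) with (t - s) in H by ring. exact H.
Qed.

Lemma Kin_contract (f x F : R -> R) :
  (forall p q, Rabs (f p - f q) <= Rabs (p - q)) ->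
  Kin x F -> Kin (fun u => f (x u)) F.
Proof.
intros Hf H s t st. apply Rle_trans with (2 := H s t st).
rewrite <- (pow2_abs (f _ - _)), <- (pow2_abs (x t - x s)).
apply pow_incr. split; [apply Rabs_pos|apply Hf].
Qed.

Lemma Kin_continuous (x F : R -> R) : Kin x F -> forall t, continuous x t.
Proof.
intros H t.
set (M := F (t + 1) - F (t - 1)).
assert (HM : 0 <= M) by (unfold M; pose proof (Kin_mono _ _ H (t - 1) (t + 1)); lra).
assert (HH : forall u, Rabs (u - t) < 1 -> (x u - x t) ^ 2 <= 2 * Rabs (u - t) * M).
{ intros u Hu. apply Rabs_def2 in Hu.
  destruct (Rtotal_order u t) as [L|[->|L]].
  - specialize (H u t L) as H'.
    rewrite Rabs_left by lra.
    pose proof (Kin_mono _ _ H (t - 1) u ltac:(lra)).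
    pose proof (Kin_mono _ _ H t (t + 1) ltac:(lra)). unfold M. nra.
  - rewrite !Rminus_diag, Rabs_R0. lra.
  - specialize (H t u L) as H'.
    rewrite Rabs_right by lra.
    pose proof (Kin_mono _ _ H u (t + 1) ltac:(lra)).
    pose proof (Kin_mono _ _ H (t - 1) t ltac:(lra)). unfold M. nra. }
apply continuity_pt_filterlim. intros eps He.
(* Within this radius the Hoelder bound is below [eps ^ 2]; the added 1 covers [M = 0]. *)
exists (Rmin 1 (eps ^ 2 / (2 * M + 1))). split.
{ apply Rmin_pos; [lra|]. apply Rdiv_lt_0_compat; nra. }
intros u [_ Hu]. simpl in *. unfold Rdist in *.
assert (H1 : Rabs (u - t) < 1) by (eapply Rlt_le_trans; [exact Hu|apply Rmin_l]).
assert (H2 : Rabs (u - t) < eps ^ 2 / (2 * M + 1)) by (eapply Rlt_le_trans; [exact Hu|apply Rmin_r]).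
specialize (HH u H1).
apply (Rmult_lt_compat_r (2 * M + 1)) in H2; [|lra].
unfold Rdiv in H2. rewrite Rmult_assoc, Rinv_l, Rmult_1_r in H2 by lra.
apply Rnot_le_lt. intros N.
assert (eps ^ 2 <= (x u - x t) ^ 2).
{ rewrite <- (pow2_abs (x u - x t)). apply pow_incr. lra. }
pose proof (Rabs_pos (u - t)). nra.
Qed.

Definition Gam (x : R -> R) : Prop := is_lim x m_infty (-1) /\ is_lim x p_infty 1.

Definition potential (b W x : R -> R) (s t : R) : R :=
  RInt (fun u => b u * W (x u)) s t.

(* [F] is a candidate for the cumulative kinetic energy of [x], so this says that
   the action of [x] on every interval is at most [e]. *)
Definition action_le (b W x F : R -> R) (e : R) : Prop :=
  Kin x F /\ forall s t, s < t -> F t - F s + potential b W x s t <= e.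

Lemma continuous_ex_RInt (f : R -> R) (s t : R) :
  (forall u, continuous f u) -> ex_RInt f s t.
Proof. intros H. apply (ex_RInt_continuous (V := R_CompleteNormedModule)). intros u _. apply H. Qed.

Section Action.

Context (b W : R -> R) (b0 : R).
Context (b_cont : forall t, continuous b t) (b0_pos : 0 < b0) (b_ge : forall t, b0 <= b t).
Context (W_cont : forall p, continuous W p) (W_ge0 : forall p, 0 <= W p).

Local Notation pot := (potential b W).
Local Notation En := (action_le b W).

Section Potential.

Context (x : R -> R) (x_cont : forall t, continuous x t).

Lemma pot_integrand_continuous (t : R) : continuous (fun u => b u * W (x u)) t.
Proof.
apply (continuous_mult b (fun u => W (x u))); [apply b_cont|].
apply (continuous_comp x W); [apply x_cont|apply W_cont].
Qed.

Lemma pot_ex (s t : R) : ex_RInt (fun u => b u * W (x u)) s t.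
Proof. apply continuous_ex_RInt, pot_integrand_continuous. Qed.

Lemma pot_Chasles (r s t : R) : pot x r s + pot x s t = pot x r t.
Proof. apply (RInt_Chasles (fun u => b u * W (x u))); apply pot_ex. Qed.

Lemma pot_integrand_ge0 (u : R) : 0 <= b u * W (x u).
Proof. apply Rmult_le_pos; [specialize (b_ge u); lra|apply W_ge0]. Qed.

Lemma pot_ge0 (s t : R) : s <= t -> 0 <= pot x s t.
Proof.
intros H. apply RInt_ge_0; [exact H|apply pot_ex|].
intros u _. apply pot_integrand_ge0.
Qed.

Lemma pot_sub (r s t v : R) : r <= s <= t -> t <= v -> pot x s t <= pot x r v.
Proof.
intros H1 H2.
pose proof (pot_Chasles r s v). pose proof (pot_Chasles s t v).
pose proof (pot_ge0 r s ltac:(lra)). pose proof (pot_ge0 t v ltac:(lra)). lra.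
Qed.

Lemma pot_lower (s t B w : R) :
  s <= t -> 0 <= B -> 0 <= w -> (forall u, s < u < t -> B <= b u) ->
  (forall u, s < u < t -> w <= W (x u)) -> B * w * (t - s) <= pot x s t.
Proof.
intros H HB Hw Hb HW. replace (B * w * (t - s)) with (RInt (fun _ => B * w) s t).
2:{ rewrite RInt_const. unfold scal; simpl; unfold mult; simpl. ring. }
apply RInt_le; [exact H|apply ex_RInt_const|apply pot_ex|].
intros u Hu. apply Rmult_le_compat; auto.
Qed.

Lemma pot_upper (s t w M : R) :
  s <= t -> (forall u, s < u < t -> b u <= M) ->
  (forall u, s < u < t -> W (x u) <= w) -> pot x s t <= M * w * (t - s).
Proof.
intros H HM HW. replace (M * w * (t - s)) with (RInt (fun _ => M * w) s t).
2:{ rewrite RInt_const. unfold scal; simpl; unfold mult; simpl. ring. }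
apply RInt_le; [exact H|apply pot_ex|apply ex_RInt_const|].
intros u Hu. apply Rmult_le_compat; [specialize (b_ge u); lra|apply W_ge0|auto|auto].
Qed.

End Potential.

Lemma pot_ext (x y : R -> R) (s t : R) :
  s <= t -> (forall u, s < u < t -> W (x u) = W (y u)) -> pot x s t = pot y s t.
Proof.
intros H E. apply RInt_ext. rewrite Rmin_left, Rmax_right by lra.
intros u Hu. now rewrite E by exact Hu.
Qed.

Lemma pot_zero (x : R -> R) (s t : R) :
  s <= t -> (forall u, s < u < t -> W (x u) = 0) -> pot x s t = 0.
Proof.
intros H E. unfold potential. rewrite (RInt_ext _ (fun _ => 0)).
- rewrite RInt_const. unfold scal; simpl; unfold mult; simpl. ring.
- rewrite Rmin_left, Rmax_right by lra. intros u Hu. rewrite E by exact Hu. apply Rmult_0_r.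
Qed.

(** Both parts of the action grow with the interval, so large intervals suffice. Modified curves can
    then be tested only on intervals containing every modification. *)
Lemma En_intro (x F : R -> R) (p q e : R) :
  Kin x F ->
  (forall s t, s <= p -> q <= t -> s < t -> F t - F s + pot x s t <= e) -> En x F e.
Proof.
intros HK H. split; [exact HK|]. intros s t st.
pose proof (Rmin_l s p). pose proof (Rmin_r s p).
pose proof (Rmax_l t q). pose proof (Rmax_r t q).
specialize (H (Rmin s p) (Rmax t q) ltac:(lra) ltac:(lra) ltac:(lra)).
pose proof (Kin_mono _ _ HK (Rmin s p) s ltac:(lra)).
pose proof (Kin_mono _ _ HK t (Rmax t q) ltac:(lra)).
pose proof (pot_sub x (Kin_continuous _ _ HK) (Rmin s p) s t (Rmax t q) ltac:(lra) ltac:(lra)).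
lra.
Qed.

Lemma En_le (x F : R -> R) (e e' : R) : En x F e -> e <= e' -> En x F e'.
Proof. intros [H1 H2] H. split; [exact H1|]. intros s t st. specialize (H2 s t st). lra. Qed.

Lemma En_holder (x F : R -> R) (e s t : R) :
  En x F e -> s <= t -> (x t - x s) ^ 2 <= 2 * e * (t - s).
Proof.
intros [HK HE] [st| ->]; [|nra].
specialize (HE s t st). specialize (HK s t st) as H1.
pose proof (pow2_ge_0 (x t - x s)).
pose proof (pot_ge0 x (Kin_continuous _ _ HK) s t ltac:(lra)). nra.
Qed.

Lemma En_ge0 (x F : R -> R) (e : R) : En x F e -> 0 <= e.
Proof.
intros [HK HE]. specialize (HE 0 1 ltac:(lra)).
pose proof (Kin_mono _ _ HK 0 1 ltac:(lra)).
pose proof (pot_ge0 x (Kin_continuous _ _ HK) 0 1 ltac:(lra)). lra.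
Qed.

Lemma En_pot (x F : R -> R) (e s t : R) : En x F e -> s <= t -> pot x s t <= e.
Proof.
intros HE [st| ->].
- destruct HE as [HK HE]. specialize (HE s t st).
  pose proof (Kin_mono _ _ HK s t ltac:(lra)). lra.
- unfold potential. rewrite RInt_point. exact (En_ge0 _ _ _ HE).
Qed.

(** Allows certificates to be normalized to vanish at 0, which bounds them pointwise and makes their
    limits along an ultrafilter exist. *)
Lemma En_shift_const (x F : R -> R) (e k : R) : En x F e -> En x (fun u => F u - k) e.
Proof.
intros [HK HE]. split; intros s t st; [specialize (HK s t st)|specialize (HE s t st)].
- replace (F t - k - (F s - k)) with (F t - F s) by ring. exact HK.
- lra.
Qed.

Lemma En_contract (f x F : R -> R) (e : R) :
  (forall p q, Rabs (f p - f q) <= Rabs (p - q)) -> (forall p, W (f p) = W p) ->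
  En x F e -> En (fun u => f (x u)) F e.
Proof.
intros Hf HW [HK HE]. split; [now apply Kin_contract|].
intros s t st. rewrite (pot_ext _ x); [auto|lra|]. intros u _. apply HW.
Qed.

End Action.

(** * The Euler-Lagrange equation *)

(** The first-variation argument: perturbing a minimizer with amplitude [d] changes the bound on its
    action by such a quadratic in [d]. *)
Lemma quadratic_ge0_linear_zero (A B : R) :
  (forall d, 0 <= d * A + d ^ 2 * B) -> A = 0.
Proof.
intros H. apply NNPP. intros NA.
assert (HB : B <= Rabs B + 1) by (pose proof (Rle_abs B); lra).
assert (Bp : 0 < Rabs B + 1) by (pose proof (Rabs_pos B); lra).
set (K := Rabs B + 1) in *. clearbody K.
(* With [K > B], this [d] gives the value [A ^ 2 * (B - 2 * K) / (4 * K ^ 2)], negative unless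
   [A = 0]. *)
specialize (H (- A / (2 * K))).
assert (A2 : 0 < A ^ 2) by (apply pow2_gt_0; exact NA).
assert (E : 0 <= ((- A / (2 * K)) * A + (- A / (2 * K)) ^ 2 * B) * (4 * K ^ 2))
  by (apply Rmult_le_pos; nra).
replace (((- A / (2 * K)) * A + (- A / (2 * K)) ^ 2 * B) * (4 * K ^ 2))
  with (A ^ 2 * (B - 2 * K)) in E by (field; lra).
nra.
Qed.

Lemma second_antiderivative (g : R -> R) :
  (forall u, continuous g u) ->
  exists Y Y1 : R -> R, (forall u, is_derive Y u (Y1 u)) /\ (forall u, is_derive Y1 u (g u)).
Proof.
intros Hg.
assert (I : forall h : R -> R, (forall u, continuous h u) ->
  exists H : R -> R, forall u, is_derive H u (h u)).
{ intros h Hh. exists (fun u => RInt h 0 u). intros u.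
  apply (is_derive_RInt h (fun u => RInt h 0 u) 0 u); [|apply Hh].
  apply filter_forall. intros v. apply (RInt_correct h), continuous_ex_RInt, Hh. }
destruct (I g Hg) as [Y1 H1].
destruct (I Y1) as [Y HY].
{ intros u. apply (ex_derive_continuous Y1). eexists. apply H1. }
exists Y, Y1. split; assumption.
Qed.

(** Slopes [t - s] on [[r, s]] and [-(s - r)] on [[s, t]], with peak [(t - s) * (s - r)]. Leaving
    the tent unnormalized avoids divisions in the second differences. *)
Definition tent (r s t u : R) : R :=
  (t - s) * hinge r u + - (t - r) * hinge s u + (s - r) * hinge t u.

Lemma tent_continuous (r s t u : R) : continuous (tent r s t) u.
Proof.
unfold tent.
apply (continuous_plus (fun u => (t - s) * hinge r u + - (t - r) * hinge s u)
                       (fun u => (s - r) * hinge t u)).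
- apply (continuous_plus (fun u => (t - s) * hinge r u) (fun u => - (t - r) * hinge s u)).
  + apply (continuous_scal_r (t - s) (hinge r)), hinge_continuous.
  + apply (continuous_scal_r (- (t - r)) (hinge s)), hinge_continuous.
- apply (continuous_scal_r (s - r) (hinge t)), hinge_continuous.
Qed.

Lemma tent_outside (r s t u : R) : r <= s <= t -> u <= r \/ t <= u -> tent r s t u = 0.
Proof.
intros H [L|L]; unfold tent.
- rewrite !hinge_l by lra. ring.
- rewrite !hinge_r by lra. ring.
Qed.

(** Two integrations by parts: the second derivative of the tent consists of point masses at [r],
    [s] and [t], so only values of [Y] survive. *)
Lemma tent_parts (g Y Y1 : R -> R) (r s t : R) :
  (forall u, continuous g u) ->
  (forall u, is_derive Y u (Y1 u)) -> (forall u, is_derive Y1 u (g u)) ->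
  r < s < t ->
  RInt (fun u => g u * tent r s t u) r t
  = (s - r) * (Y t - Y s) - (t - s) * (Y s - Y r).
Proof.
intros Hg HY HY1 H.
assert (C : forall u, continuous (fun u => g u * tent r s t u) u).
{ intros u. apply (continuous_mult g (tent r s t)); [apply Hg|apply tent_continuous]. }
rewrite <- (RInt_Chasles (fun u => g u * tent r s t u) r s t)
  by (apply continuous_ex_RInt, C).
(* On each half the tent is affine and vanishes at an endpoint [al]; this is an explicit primitive
   of [g] times such a function. *)
assert (D : forall (al k : R) u,
  is_derive (fun v => k * ((v - al) * Y1 v - Y v)) u (k * (g u * (u - al)))).
{ intros al k u. auto_derive.
  - repeat split; eexists; [apply HY1|apply HY].
  - rewrite (is_derive_unique (fun v : R => Y v) u _ (HY u)), (is_derive_unique (fun v : R => Y1 v) u _ (HY1 u)). ring. }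
assert (I : forall al k p q,
  RInt (fun u => k * (g u * (u - al))) p q
  = k * ((q - al) * Y1 q - Y q) - k * ((p - al) * Y1 p - Y p)).
{ intros al k p q. apply is_RInt_unique.
  apply (is_RInt_derive (fun v => k * ((v - al) * Y1 v - Y v))).
  - intros u _. apply D.
  - intros u _. apply (continuous_scal_r k (fun u => g u * (u - al))).
    apply (continuous_mult g (fun u => u - al)); [apply Hg|].
    apply (continuous_minus (fun u => u) (fun _ => al));
      [apply continuous_id|apply continuous_const]. }
rewrite (RInt_ext _ (fun u => (t - s) * (g u * (u - r))) r s).
2:{ rewrite Rmin_left, Rmax_right by lra. intros u Hu. unfold tent.
    rewrite hinge_r, !hinge_l by lra. simpl. lra. }
rewrite (RInt_ext _ (fun u => - (s - r) * (g u * (u - t))) s t).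
2:{ rewrite Rmin_left, Rmax_right by lra. intros u Hu. unfold tent.
    rewrite !hinge_r, !hinge_l by lra. simpl. lra. }
rewrite !I. unfold plus; simpl. ring.
Qed.

Lemma Gam_ext (x y : R -> R) (p q : R) :
  (forall u, u <= p \/ q <= u -> x u = y u) -> Gam x -> Gam y.
Proof.
intros E [H1 H2]. split.
- apply is_lim_ext_loc with (2 := H1). exists p. intros u Hu. apply E. lra.
- apply is_lim_ext_loc with (2 := H2). exists q. intros u Hu. apply E. lra.
Qed.

Section EulerLagrange.

Context (b W dW : R -> R) (b0 C : R).
Context (b_cont : forall t, continuous b t) (b0_pos : 0 < b0) (b_ge : forall t, b0 <= b t).
Context (W_cont : forall p, continuous W p) (W_ge0 : forall p, 0 <= W p).
Context (dW_cont : forall p, continuous dW p).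
Context (W_quad : forall p q, -1 <= p <= 1 ->
  W q <= W p + dW p * (q - p) + C * (q - p) ^ 2).
Context (x F : R -> R) (c : R).
Context (x_Gam : Gam x) (x_bd : forall t, -1 <= x t <= 1) (x_act : action_le b W x F c).
Context (x_min : forall y G e, Gam y -> action_le b W y G e -> c <= e).

Let x_cont : forall t, continuous x t := Kin_continuous x F (proj1 x_act).

Lemma force_continuous (u : R) : continuous (fun u => b u * dW (x u)) u.
Proof.
apply (continuous_mult b (fun u => dW (x u))); [apply b_cont|].
apply (continuous_comp x dW); [apply x_cont|apply dW_cont].
Qed.

(** Compare [x] with [x + d * tent]. The kinetic change is exact and [W_quad] bounds the potential
    change, so minimality forces the term linear in [d] to vanish. *)
Lemma weak_Euler_Lagrange (r s t : R) :
  r < s < t ->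
  (t - s) * (x s - x r) - (s - r) * (x t - x s)
  + RInt (fun u => b u * dW (x u) * tent r s t u) r t = 0.
Proof.
intros H.
set (A := RInt (fun u => b u * dW (x u) * tent r s t u) r t).
set (B := RInt (fun u => b u * (C * tent r s t u ^ 2)) r t).
(* The first summand is the kinetic energy of the tent itself, half the integral of its squared
   slope. *)
apply (quadratic_ge0_linear_zero _ ((t - s) * (s - r) * (t - r) / 2 + B)).
intros d.
set (y1 := fun u => x u + (d * (t - s)) * hinge r u).
set (y2 := fun u => y1 u + (- d * (t - r)) * hinge s u).
set (y := fun u => y2 u + (d * (s - r)) * hinge t u).
set (G1 := fun u => F u + hinge_cost x (d * (t - s)) r u).
set (G2 := fun u => G1 u + hinge_cost y1 (- d * (t - r)) s u).
set (G := fun u => G2 u + hinge_cost y2 (d * (s - r)) t u).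
assert (Ey : forall u, y u = x u + d * tent r s t u).
{ intros u. unfold y, y2, y1, tent. ring. }
assert (KG : Kin y G).
{ unfold y, G. apply Kin_hinge. unfold y2, G2. apply Kin_hinge.
  unfold y1, G1. apply Kin_hinge. apply x_act. }
assert (Ct : forall u, continuous (fun u => b u * dW (x u) * tent r s t u) u).
{ intros u. apply (continuous_mult (fun u => b u * dW (x u)) (tent r s t));
    [apply force_continuous|apply tent_continuous]. }
assert (Ct2 : forall u, continuous (fun u => b u * (C * tent r s t u ^ 2)) u).
{ intros u. apply (continuous_mult b (fun u => C * tent r s t u ^ 2)); [apply b_cont|].
  apply (continuous_scal_r C (fun u => tent r s t u ^ 2)).
  apply (continuous_comp (tent r s t) (fun p => p ^ 2)); [apply tent_continuous|].
  apply (ex_derive_continuous (fun p : R => p ^ 2)). auto_derive. exact I. }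
assert (Cp : forall u, continuous (fun u => b u * W (x u)) u)
  by (intros u; now apply pot_integrand_continuous).
(* [W_quad] only needs its base point [x u] in [[-1, 1]]; the perturbed value [y u] may leave that
   interval. *)
assert (PI : potential b W y r t <= potential b W x r t + (d * A + d ^ 2 * B)).
{ unfold potential, A, B.
  rewrite <- (RInt_scal (V := R_CompleteNormedModule)) by (apply continuous_ex_RInt, Ct).
  rewrite <- (RInt_scal (V := R_CompleteNormedModule)) by (apply continuous_ex_RInt, Ct2).
  rewrite <- (RInt_plus (V := R_CompleteNormedModule)).
  2,3: apply (ex_RInt_scal (V := R_CompleteNormedModule)), continuous_ex_RInt; assumption.
  rewrite <- (RInt_plus (V := R_CompleteNormedModule)).
  2: apply continuous_ex_RInt, Cp.
  2: apply (ex_RInt_plus (V := R_CompleteNormedModule));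
     apply (ex_RInt_scal (V := R_CompleteNormedModule)), continuous_ex_RInt; assumption.
  apply RInt_le; [lra| | |].
  - apply (pot_ex b W b_cont W_cont y (Kin_continuous _ _ KG)).
  - apply (ex_RInt_plus (V := R_CompleteNormedModule)); [apply continuous_ex_RInt, Cp|].
    apply (ex_RInt_plus (V := R_CompleteNormedModule));
     apply (ex_RInt_scal (V := R_CompleteNormedModule)), continuous_ex_RInt; assumption.
  - intros u _. unfold plus, scal; simpl; unfold mult; simpl.
    pose proof (W_quad (x u) (y u) (x_bd u)) as Q.
    replace (y u - x u) with (d * tent r s t u) in Q by (rewrite Ey; ring).
    apply (Rmult_le_compat_l (b u)) in Q; [|specialize (b_ge u); lra].
    apply Rle_trans with (1 := Q). apply Req_le. ring. }
cut (c <= c + (d * ((t - s) * (x s - x r) - (s - r) * (x t - x s) + A)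
  + d ^ 2 * ((t - s) * (s - r) * (t - r) / 2 + B))); [lra|].
apply (x_min y G).
{ apply Gam_ext with (p := r) (q := t) (2 := x_Gam). intros u Hu.
  rewrite Ey, tent_outside by lra. ring. }
apply (En_intro b W b0 b_cont b0_pos b_ge W_cont W_ge0) with (p := r) (q := t); [exact KG|].
intros S T HS HT ST.
assert (EG : G T - G S = F T - F S + (d * ((t - s) * (x s - x r) - (s - r) * (x t - x s))
  + d ^ 2 * ((t - s) * (s - r) * (t - r) / 2))).
{ unfold G, G2, G1. rewrite !(hinge_cost_l _ _ _ S) by lra.
  rewrite !(hinge_cost_r _ _ _ T) by lra. unfold y2, y1.
  rewrite !(hinge_r _ T), (hinge_r r s), (hinge_r r t), (hinge_r s t) by lra.
  field. }
pose proof (pot_Chasles b W b_cont W_cont y (Kin_continuous _ _ KG)) as Py.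
pose proof (pot_Chasles b W b_cont W_cont x x_cont) as Px.
pose proof (Py S r T) as Py1. pose proof (Py r t T) as Py2.
pose proof (Px S r T) as Px1. pose proof (Px r t T) as Px2.
rewrite (pot_ext b W y x S r) in Py1
  by (try lra; intros u Hu; rewrite Ey, tent_outside by lra; f_equal; ring).
rewrite (pot_ext b W y x t T) in Py2
  by (try lra; intros u Hu; rewrite Ey, tent_outside by lra; f_equal; ring).
pose proof (proj2 x_act S T ST). rewrite EG. lra.
Qed.

Lemma Euler_Lagrange :
  exists x1 : R -> R, (forall u, is_derive x u (x1 u)) /\
    (forall u, is_derive x1 u (b u * dW (x u))).
Proof.
destruct (second_antiderivative _ force_continuous) as [Y [Y1 [HY HY1]]].
set (z := fun u => x u - Y u).
assert (Z : forall r s t, r < s < t -> (t - s) * (z s - z r) = (s - r) * (z t - z s)).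
{ intros r s t H. pose proof (weak_Euler_Lagrange r s t H) as E.
  rewrite (tent_parts _ Y Y1 r s t force_continuous HY HY1 H) in E. unfold z. lra. }
(* The tents only see second differences, which vanish for [x - Y]: it is affine. *)
assert (E : forall u, x u = Y u + (z 0 + (z 1 - z 0) * u)).
{ intros u. enough (z u = z 0 + (z 1 - z 0) * u) by (unfold z in *; lra).
  destruct (Rtotal_order u 0) as [L|[->|L]]; [|ring|].
  - specialize (Z u 0 1 ltac:(lra)). lra.
  - destruct (Rtotal_order u 1) as [L'|[->|L']]; [|ring|].
    + specialize (Z 0 u 1 ltac:(lra)). lra.
    + specialize (Z 0 1 u ltac:(lra)). lra. }
exists (fun u => Y1 u + (z 1 - z 0)). split; intros u.
- apply is_derive_ext with (f := fun u => Y u + (z 0 + (z 1 - z 0) * u)).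
  { intros v. now rewrite E. }
  auto_derive; [eexists; apply HY|].
  rewrite (is_derive_unique (fun v : R => Y v) u _ (HY u)). ring.
- auto_derive; [eexists; apply HY1|].
  rewrite (is_derive_unique (fun v : R => Y1 v) u _ (HY1 u)). ring.
Qed.

End EulerLagrange.

(** * Uniqueness at equilibria and strict bounds *)

Lemma continuous_bounded_above (f : R -> R) (p q : R) :
  (forall t, continuous f t) -> exists M, 0 < M /\ forall u, p <= u <= q -> f u <= M.
Proof.
intros Hf. destruct (Rle_lt_dec p q) as [pq|pq].
- destruct (continuity_ab_maj f p q pq) as [m [Hm _]].
  { intros u _. apply continuity_pt_filterlim, Hf. }
  exists (Rmax 1 (f m)). split.
  + apply Rlt_le_trans with (2 := Rmax_l _ _). lra.
  + intros u Hu. apply Rle_trans with (2 := Rmax_r _ _). auto.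
- exists 1. split; [lra|]. intros u Hu. lra.
Qed.

Lemma is_derive_extremum (x : R -> R) (t d : R) :
  is_derive x t d -> (forall u, x u <= x t) \/ (forall u, x t <= x u) -> d = 0.
Proof.
intros Hd H. apply is_derive_Reals in Hd.
pose (pr := exist _ d Hd : derivable_pt x t).
assert (E : derive_pt x t pr = d) by (apply derive_pt_eq_0, Hd).
rewrite <- E. destruct H as [H|H].
- apply (deriv_maximum x (t - 1) (t + 1)); try lra; auto.
- apply (deriv_minimum x (t - 1) (t + 1)); try lra; auto.
Qed.

Lemma derive_le0_decreasing (f df : R -> R) (p q : R) :
  p <= q -> (forall u, is_derive f u (df u)) ->
  (forall u, p <= u <= q -> df u <= 0) -> f q <= f p.
Proof.
intros pq Hf Hdf.
destruct (MVT_gen f p q df) as [u [Hu E]].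
- intros u _. apply Hf.
- intros u _. apply continuity_pt_filterlim, (ex_derive_continuous f). eexists. apply Hf.
- rewrite Rmin_left, Rmax_right in Hu by lra. specialize (Hdf u Hu). nra.
Qed.

(* Gronwall for (x - rho)^2 + x'^2, run in both time directions. *)
Lemma equilibrium_unique (x x1 q : R -> R) (rho K l r t0 : R) :
  (forall u, is_derive x u (x1 u)) -> (forall u, is_derive x1 u (q u)) ->
  0 <= K -> (forall u, l <= u <= r -> Rabs (q u) <= K * Rabs (x u - rho)) ->
  l <= t0 <= r -> x t0 = rho -> x1 t0 = 0 ->
  forall u, l <= u <= r -> x u = rho.
Proof.
intros Hx Hx1 HK Hq Ht0 E0 E1 u Hu.
set (N := fun v => (x v - rho) ^ 2 + x1 v ^ 2).
set (dN := fun v => 2 * (x v - rho) * x1 v + 2 * x1 v * q v).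
assert (HN : forall v, is_derive N v (dN v)).
{ intros v. unfold N, dN. auto_derive.
  - repeat split; eexists; [apply Hx|apply Hx1].
  - rewrite (is_derive_unique (fun w : R => x w) v _ (Hx v)),
      (is_derive_unique (fun w : R => x1 w) v _ (Hx1 v)). ring. }
assert (B : forall v, l <= v <= r -> Rabs (dN v) <= (1 + K) * N v).
{ intros v Hv. specialize (Hq v Hv). unfold dN, N.
  apply Rle_trans with (2 * Rabs (x v - rho) * Rabs (x1 v) + 2 * Rabs (x1 v) * Rabs (q v)).
  - eapply Rle_trans; [apply Rabs_triang|]. rewrite !Rabs_mult, (Rabs_right 2) by lra. lra.
  - rewrite <- (pow2_abs (x v - rho)), <- (pow2_abs (x1 v)).
    pose proof (Rabs_pos (x v - rho)). pose proof (Rabs_pos (x1 v)).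
    set (A := Rabs (x v - rho)) in *. set (D := Rabs (x1 v)) in *. set (Q := Rabs (q v)) in *.
    clearbody A D Q. pose proof (pow2_ge_0 (A - D)).
    assert (2 * D * Q <= 2 * D * (K * A)) by (apply Rmult_le_compat_l; lra). nra. }
assert (N0 : N t0 = 0) by (unfold N; rewrite E0, E1; ring).
assert (NU : N u <= 0).
{ destruct (Rle_lt_dec t0 u) as [L|L].
  - set (f := fun v => N v * exp (- (1 + K) * v)).
    assert (I : f u <= f t0).
    { apply (derive_le0_decreasing f (fun v => (dN v - (1 + K) * N v) * exp (- (1 + K) * v)));
        [exact L| |].
      - intros v. unfold f. auto_derive; [eexists; apply HN|].
        rewrite (is_derive_unique (fun w : R => N w) v _ (HN v)). ring.
      - intros v Hv. specialize (B v ltac:(lra)). apply Rabs_le_between in B.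
        pose proof (exp_pos (- (1 + K) * v)). nra. }
    unfold f in I. rewrite N0, Rmult_0_l in I.
    pose proof (exp_pos (- (1 + K) * u)). nra.
  - set (f := fun v => - N v * exp ((1 + K) * v)).
    assert (I : f t0 <= f u).
    { apply (derive_le0_decreasing f (fun v => (- dN v - (1 + K) * N v) * exp ((1 + K) * v)));
        [lra| |].
      - intros v. unfold f. auto_derive; [eexists; apply HN|].
        rewrite (is_derive_unique (fun w : R => N w) v _ (HN v)). ring.
      - intros v Hv. specialize (B v ltac:(lra)). apply Rabs_le_between in B.
        pose proof (exp_pos ((1 + K) * v)). nra. }
    unfold f in I. rewrite N0 in I.
    pose proof (exp_pos ((1 + K) * u)). nra. }
unfold N in NU. pose proof (pow2_ge_0 (x u - rho)). pose proof (pow2_ge_0 (x1 u)).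
assert (Z : (x u - rho) * (x u - rho) = 0) by lra.
apply Rmult_integral in Z. lra.
Qed.

(** Touching 1 or -1 happens at an extremum, hence with zero velocity; uniqueness then makes [x]
    constant, which contradicts its two different limits. *)
Lemma heteroclinic_strict (b dW x x1 : R -> R) (C : R) :
  (forall t, continuous b t) -> (forall t, 0 <= b t) -> 0 <= C ->
  (forall p, -1 <= p <= 1 -> Rabs (dW p) <= C * Rabs (p - 1)) ->
  (forall p, -1 <= p <= 1 -> Rabs (dW p) <= C * Rabs (p - -1)) ->
  (forall u, is_derive x u (x1 u)) -> (forall u, is_derive x1 u (b u * dW (x u))) ->
  (forall t, -1 <= x t <= 1) -> Gam x -> forall t, -1 < x t < 1.
Proof.
intros Hb b0 C0 D1 D2 Hx Hx1 bd [G1 G2] t.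
assert (S : forall rho, (forall p, -1 <= p <= 1 -> Rabs (dW p) <= C * Rabs (p - rho)) ->
  x t = rho -> x1 t = 0 -> forall u, x u = rho).
{ intros rho D E0 E1 u.
  (* [b] may be unbounded, so the Gronwall constant is taken on the interval between [u] and [t]
     only. *)
  destruct (continuous_bounded_above b (Rmin u t) (Rmax u t) Hb) as [M [M0 HM]].
  pose proof (Rmin_l u t). pose proof (Rmin_r u t).
  pose proof (Rmax_l u t). pose proof (Rmax_r u t).
  apply (equilibrium_unique x x1 _ rho (M * C) (Rmin u t) (Rmax u t) t Hx Hx1); try lra.
  - apply Rmult_le_pos; lra.
  - intros v Hv. rewrite Rabs_mult, (Rabs_right (b v)) by (specialize (b0 v); lra).
    rewrite Rmult_assoc. apply Rmult_le_compat; auto. apply Rabs_pos. }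
assert (L : forall rho, (forall u, x u = rho) -> rho = -1 /\ rho = 1).
{ intros rho E. split.
  - apply (is_lim_ext x (fun _ => rho)) in G1; [|exact E].
    apply is_lim_unique in G1. rewrite Lim_const in G1. now injection G1.
  - apply (is_lim_ext x (fun _ => rho)) in G2; [|exact E].
    apply is_lim_unique in G2. rewrite Lim_const in G2. now injection G2. }
split; apply Rnot_le_lt; intros N; specialize (bd t) as Bt.
- assert (E : x t = -1) by lra.
  destruct (L (-1)) as [_ ?]; [|lra]. apply S; auto.
  apply (is_derive_extremum x t _ (Hx t)). right. intros u. specialize (bd u). lra.
- assert (E : x t = 1) by lra.
  destruct (L 1) as [? _]; [|lra]. apply S; auto.
  apply (is_derive_extremum x t _ (Hx t)). left. intros u. specialize (bd u). lra.
Qed.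

(** * Compactness *)

(** Time reversal turns the tail at minus infinity into one at plus infinity. *)
Lemma action_le_reverse (b W x F : R -> R) (e : R) :
  (forall t, continuous b t) -> (forall p, continuous W p) ->
  action_le b W x F e ->
  action_le (fun t => b (- t)) W (fun t => x (- t)) (fun t => - F (- t)) e.
Proof.
intros Hb HW [HK HE]. split; [now apply Kin_reverse|]. intros s t st.
specialize (HE (- t) (- s) ltac:(lra)).
assert (E : potential (fun t => b (- t)) W (fun t => x (- t)) s t = potential b W x (- t) (- s)).
{ unfold potential. apply is_RInt_unique.
  pose proof (RInt_correct _ _ _ (pot_ex b W Hb HW x (Kin_continuous _ _ HK) (- t) (- s))) as I.
  apply is_RInt_swap, (is_RInt_comp_opp (fun u => b u * W (x u)) s t), is_RInt_opp in I.
  rewrite opp_opp in I. revert I. apply is_RInt_ext.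
  intros u _. apply (opp_opp (b (- u) * W (x (- u)))). }
rewrite E. lra.
Qed.

Lemma double_well_lower (W : R -> R) (eta : R) :
  (forall p, continuous W p) -> (forall p, -1 < p < 1 -> 0 < W p) -> 0 < eta <= 1 ->
  exists w, 0 < w /\ forall p, Rabs p <= 1 - eta -> w <= W p.
Proof.
intros HW Wp He.
destruct (continuity_ab_min W (- (1 - eta)) (1 - eta)) as [m [Hm Im]]; [lra| |].
{ intros p _. apply continuity_pt_filterlim, HW. }
exists (W m). split; [apply Wp; lra|].
intros p Hp. apply Rabs_le_between in Hp. apply Hm. lra.
Qed.

Section Dip.

Context (b W : R -> R) (b0 : R).
Context (b_cont : forall t, continuous b t) (b0_pos : 0 < b0) (b_ge : forall t, b0 <= b t).
Context (W_cont : forall p, continuous W p) (W_ge0 : forall p, 0 <= W p).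
Context (x F : R -> R) (e : R) (x_act : action_le b W x F e).

Lemma action_holder_abs (d eta s t : R) :
  0 <= eta -> 2 * e * d <= eta ^ 2 -> Rabs (t - s) <= d -> Rabs (x t - x s) <= eta.
Proof.
intros H0 Hd Hst. apply Rabs_le_between in Hst.
assert (e0 : 0 <= e) by (eapply (En_ge0 b W b0); eassumption).
assert (Q : (x t - x s) ^ 2 <= eta ^ 2).
{ destruct (Rle_lt_dec s t) as [L|L].
  - assert (H : (x t - x s) ^ 2 <= 2 * e * (t - s))
      by (eapply (En_holder b W b0); eassumption). nra.
  - assert (H : (x s - x t) ^ 2 <= 2 * e * (s - t))
      by (eapply (En_holder b W b0); try eassumption; lra). nra. }
rewrite <- (pow2_abs (x t - x s)) in Q.
apply Rnot_lt_le. intros N. pose proof (Rabs_pos (x t - x s)). nra.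
Qed.

(** A dip away from the wells lasts for a time [d] independent of where it occurs, so every dip
    costs a definite amount of potential energy. *)
Lemma dip_stays (d eta t0 u : R) :
  0 <= eta -> 8 * e * d <= eta ^ 2 -> Rabs (x t0) <= 1 - eta -> Rabs (u - t0) <= d ->
  Rabs (x u) <= 1 - eta / 2.
Proof.
intros H0 Hd Ht Hu.
assert (H : Rabs (x u - x t0) <= eta / 2)
  by (apply (action_holder_abs d); try assumption; nra).
replace (x u) with (x t0 + (x u - x t0)) by ring.
pose proof (Rabs_triang (x t0) (x u - x t0)). lra.
Qed.

(** Otherwise dips to [1 - eta] recur arbitrarily late. Each costs at least [b0 * w * d] over
    disjoint time spans, and enough of them exceed the budget [e]. *)
Lemma tail_well (T : R) :
  (forall p, -1 < p < 1 -> 0 < W p) ->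
  forall eta, 0 < eta <= 1 -> exists S, T <= S /\ forall u, S <= u -> 1 - eta < Rabs (x u).
Proof.
intros Wp eta He. apply NNPP. intros N.
destruct (double_well_lower W (eta / 2) W_cont Wp ltac:(lra)) as [w [w0 Hw]].
assert (e0 : 0 <= e) by (eapply (En_ge0 b W b0); eassumption).
(* The span required by [dip_stays]; the added 1 covers [e = 0]. *)
set (d := eta ^ 2 / (8 * e + 1)).
assert (d0 : 0 < d) by (apply Rdiv_lt_0_compat; nra).
assert (Hd : 8 * e * d <= eta ^ 2).
{ unfold d. apply Rmult_le_reg_r with (8 * e + 1); [lra|].
  replace (8 * e * (eta ^ 2 / (8 * e + 1)) * (8 * e + 1)) with (8 * e * eta ^ 2) by (field; lra).
  nra. }
assert (xc : forall t, continuous x t) by exact (Kin_continuous x F (proj1 x_act)).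
assert (I : forall n, exists S, T <= S /\ INR n * (b0 * w * d) <= potential b W x T S).
{ induction n as [|n [S [HS IH]]].
  - exists T. split; [lra|]. rewrite Rmult_0_l. eapply (pot_ge0 b W b0); eauto. lra.
  - assert (exists u, S <= u /\ Rabs (x u) <= 1 - eta) as [u [Hu Du]].
    { apply NNPP. intros N'. apply N. exists S. split; [exact HS|]. intros u Hu.
      apply Rnot_le_lt. intros Q. apply N'. now exists u. }
    exists (u + d). split; [lra|].
    assert (P1 : b0 * w * (u + d - u) <= potential b W x u (u + d)).
    { apply pot_lower; auto; try lra. intros v Hv. apply Hw.
      apply (dip_stays d eta u v); try lra. apply Rabs_le. lra. }
    assert (P2 : potential b W x T S + potential b W x S (u + d) = potential b W x T (u + d))
      by (eapply (pot_Chasles b W); eauto).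
    assert (P3 : potential b W x u (u + d) <= potential b W x S (u + d))
      by (eapply (pot_sub b W b0); eauto; lra).
    rewrite S_INR. lra. }
assert (k0 : 0 < b0 * w * d) by (apply Rmult_lt_0_compat; [nra|exact d0]).
destruct (nfloor_ex (e / (b0 * w * d))) as [n [_ Hn]].
{ apply Rdiv_le_0_compat; lra. }
destruct (I (S n)) as [S [HS HI]]. rewrite S_INR in HI.
assert (potential b W x T S <= e) by (eapply (En_pot b W b0); eauto).
apply (Rmult_lt_compat_r (b0 * w * d)) in Hn; [|exact k0].
unfold Rdiv in Hn. rewrite Rmult_assoc, Rinv_l, Rmult_1_r in Hn by lra. lra.
Qed.

Lemma tail_limit (rho T : R) :
  (forall p, -1 < p < 1 -> 0 < W p) ->
  rho = 1 \/ rho = -1 -> (forall u, -1 <= x u <= 1) -> (forall u, T < u -> 0 <= rho * x u) ->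
  is_lim x p_infty rho.
Proof.
intros Wp Hr bd sg. apply is_lim_spec. intros eps.
assert (H1 : 0 < Rmin 1 eps <= 1).
{ split; [apply Rmin_pos; [lra|apply eps]|apply Rmin_l]. }
destruct (tail_well (T + 1) Wp (Rmin 1 eps) H1) as [S [HS H]].
exists S. intros u Hu. specialize (H u ltac:(lra)). specialize (sg u ltac:(lra)).
specialize (bd u). pose proof (Rmin_r 1 eps).
destruct Hr as [-> | ->].
- rewrite (Rabs_right (x u)) in H by lra. apply Rabs_def1; lra.
- rewrite (Rabs_left1 (x u)) in H by lra. apply Rabs_def1; lra.
Qed.

End Dip.

(** Recovers the boundary conditions, which pointwise limits need not preserve: bounded action
    drives [|x|] to 1 in both tails and the sign selects the well. *)
Lemma sided_Gam (b W x F : R -> R) (b0 e T : R) :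
  (forall t, continuous b t) -> 0 < b0 -> (forall t, b0 <= b t) ->
  (forall p, continuous W p) -> (forall p, 0 <= W p) -> (forall p, -1 < p < 1 -> 0 < W p) ->
  action_le b W x F e -> (forall u, -1 <= x u <= 1) ->
  (forall u, T < u -> 0 <= x u) -> (forall u, u < - T -> x u <= 0) -> Gam x.
Proof.
intros Hb Hb0 Hge Wc W0 Wp HE bd HR HL. split.
- assert (H : is_lim (fun u => x (- u)) p_infty (-1)).
  { apply (tail_limit (fun t => b (- t)) W b0) with (F := fun t => - F (- t)) (e := e) (T := T);
      auto.
    - intros t. apply (continuous_comp Ropp b); [|apply Hb].
      apply (continuous_opp (fun t : R => t)), continuous_id.
    - now apply action_le_reverse.
    - intros u Hu. specialize (HL (- u) ltac:(lra)). lra. }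
  apply is_lim_ext with (f := fun u => x (- - u)); [intros; f_equal; ring|].
  apply (is_lim_comp (fun u => x (- u)) Ropp m_infty (-1) p_infty H).
  + apply (is_lim_opp (fun u => u) m_infty m_infty), is_lim_id.
  + exists 0. intros u _. discriminate.
- apply (tail_limit b W b0) with (F := F) (e := e) (T := T); auto.
  intros u Hu. specialize (HR u Hu). lra.
Qed.

Section Compactness.

Context (b W : R -> R) (b0 K : R).
Context (b_cont : forall t, continuous b t) (b0_pos : 0 < b0) (b_ge : forall t, b0 <= b t).
Context (W_cont : forall p, continuous W p) (W_ge0 : forall p, 0 <= W p).
Context (K_ge0 : 0 <= K).
Context (W_lip : forall p q, Rabs (W p - W q) <= K * Rabs (p - q)).

Lemma pot_close (x y : R -> R) (M eta s t : R) :
  (forall t, continuous x t) -> (forall t, continuous y t) -> s <= t ->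
  (forall u, s <= u <= t -> b u <= M) ->
  (forall u, s <= u <= t -> Rabs (y u - x u) <= eta) ->
  potential b W x s t <= potential b W y s t + M * K * eta * (t - s).
Proof.
intros xc yc st HM Hy.
replace (M * K * eta * (t - s)) with (RInt (fun _ => M * K * eta) s t).
2:{ rewrite RInt_const. unfold scal; simpl; unfold mult; simpl. ring. }
unfold potential.
rewrite <- (RInt_plus (V := R_CompleteNormedModule) (fun u => b u * W (y u))).
2: now apply pot_ex.
2: apply ex_RInt_const.
apply RInt_le; [exact st|now apply pot_ex| |].
{ apply (ex_RInt_plus (V := R_CompleteNormedModule) (fun u => b u * W (y u)));
    [now apply pot_ex|apply ex_RInt_const]. }
intros u Hu. unfold plus; simpl.
specialize (HM u ltac:(lra)). specialize (Hy u ltac:(lra)).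
pose proof (W_lip (y u) (x u)) as L. apply Rabs_le_between in L.
assert (K * Rabs (y u - x u) <= K * eta) by now apply Rmult_le_compat_l.
specialize (b_ge u). pose proof (Rabs_pos (y u - x u)).
assert (b u * (W (x u) - W (y u)) <= b u * (K * eta)) by (apply Rmult_le_compat_l; lra).
assert (b u * (K * eta) <= M * (K * eta))
  by (apply Rmult_le_compat_r; [apply Rmult_le_pos; lra|lra]).
lra.
Qed.

Context (U : ((R -> R) * (R -> R) -> Prop) -> Prop).
Context (U_proper : ProperFilter U).
Context (x F : R -> R) (c : R) (c_ge0 : 0 <= c).
Context (x_lim : forall t, filterlim (fun p : (R -> R) * (R -> R) => fst p t) U (locally (x t))).
Context (F_lim : forall t, filterlim (fun p : (R -> R) * (R -> R) => snd p t) U (locally (F t))).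
Context (U_act : forall d, 0 < d -> U (fun p => action_le b W (fst p) (snd p) (c + d))).

Local Instance U_filter : Filter U := filter_filter.

Lemma limit_Kin : Kin x F.
Proof.
intros s t st.
assert (Lx : filterlim (fun p : (R -> R) * (R -> R) => fst p t - fst p s) U (locally (x t - x s))).
{ apply (filterlim_comp_2 (G := locally (x t)) (H := locally (opp (x s)))
    (fun p : (R -> R) * (R -> R) => fst p t) (fun p => opp (fst p s)) plus).
  - apply x_lim.
  - apply filterlim_comp with (2 := filterlim_opp (x s)). apply x_lim.
  - apply (filterlim_plus (V := R_NormedModule) (x t) (opp (x s))). }
assert (LF : filterlim (fun p : (R -> R) * (R -> R) => snd p t - snd p s) U (locally (F t - F s))).
{ apply (filterlim_comp_2 (G := locally (F t)) (H := locally (opp (F s)))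
    (fun p : (R -> R) * (R -> R) => snd p t) (fun p => opp (snd p s)) plus).
  - apply F_lim.
  - apply filterlim_comp with (2 := filterlim_opp (F s)). apply F_lim.
  - apply (filterlim_plus (V := R_NormedModule) (F t) (opp (F s))). }
change (Rbar_le (Finite ((x t - x s) ^ 2)) (Finite (2 * (t - s) * (F t - F s)))).
apply (filterlim_le (F := U) (fun p => (fst p t - fst p s) ^ 2)
  (fun p => 2 * (t - s) * (snd p t - snd p s))).
- generalize (U_act 1 Rlt_0_1). apply filter_imp. intros p [HK _]. now apply HK.
- apply filterlim_comp with (1 := Lx) (g := fun v : R => v ^ 2).
  apply (ex_derive_continuous (fun v : R => v ^ 2)). auto_derive. exact I.
- apply filterlim_comp with (1 := LF) (g := fun v : R => 2 * (t - s) * v).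
  apply (ex_derive_continuous (fun v : R => 2 * (t - s) * v)). auto_derive. exact I.
Qed.

Lemma limit_energy_raw (s t d : R) :
  s < t -> 0 < d -> U (fun p => snd p t - snd p s <= F t - F s + d /\ F t - F s <= snd p t - snd p s + d).
Proof.
intros st Hd.
assert (H2 : 0 < d / 2) by lra.
pose proof (proj1 (filterlim_locally _ _) (F_lim t) (mkposreal _ H2)) as Ht.
pose proof (proj1 (filterlim_locally _ _) (F_lim s) (mkposreal _ H2)) as Hs.
generalize (filter_and _ _ Ht Hs). apply filter_imp. intros p [A B].
unfold ball in A, B; simpl in A, B; unfold AbsRing_ball, abs, minus, plus, opp in A, B;
  simpl in A, B.
apply Rabs_def2 in A, B. lra.
Qed.

Lemma limit_holder (s t : R) : s <= t -> (x t - x s) ^ 2 <= 2 * (c + 1) * (t - s).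
Proof.
intros [st| ->]; [|nra].
pose proof (limit_Kin s t st) as HK.
assert (F t - F s <= c + 1).
{ apply Rnot_lt_le. intros N.
  (* One half of the slack goes to the action bound, the other to the convergence of the
     certificates. *)
  assert (h2 : 0 < 1 / 2) by lra.
  destruct (filter_ex _ (filter_and _ _ (U_act (1 / 2) h2)
    (limit_energy_raw s t (1 / 2) st h2))) as [p [A [_ B]]].
  pose proof (proj2 A s t st) as E.
  assert (0 <= potential b W (fst p) s t).
  { apply (pot_ge0 b W b0 b_cont b0_pos b_ge W_cont W_ge0); [|lra].
    exact (Kin_continuous _ _ (proj1 A)). }
  lra. }
nra.
Qed.

(** Equi-Hoelder continuity upgrades convergence at the nodes of a grid to uniform convergence, one
    cell of length [h] at a time. *)
Lemma limit_uniform (eta s t : R) :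
  0 < eta -> U (fun p => forall u, s <= u <= t -> Rabs (fst p u - x u) <= eta).
Proof.
intros He.
(* Over a time [h], both the curves and the limit move by at most [eta / 3]. *)
set (h := eta ^ 2 / (18 * (c + 1))).
assert (h0 : 0 < h) by (apply Rdiv_lt_0_compat; [apply pow_lt|]; lra).
assert (Hh : 2 * (c + 1) * h <= (eta / 3) ^ 2)
  by (unfold h; apply Req_le; field; lra).
assert (I : forall n : nat,
  U (fun p => forall u, s <= u <= s + INR n * h -> Rabs (fst p u - x u) <= eta)).
{ induction n as [|n IH].
  - rewrite Rmult_0_l, Rplus_0_r.
    generalize (proj1 (filterlim_locally _ _) (x_lim s) (mkposreal _ He)).
    apply filter_imp. intros p A u Hu. replace u with s by lra.
    unfold ball in A; simpl in A; unfold AbsRing_ball, abs, minus, plus, opp in A; simpl in A.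
    left. exact A.
  - set (v := s + INR n * h) in *.
    replace (s + INR (S n) * h) with (v + h) by (rewrite S_INR; unfold v; ring).
    assert (H3 : 0 < eta / 3) by lra.
    pose proof (proj1 (filterlim_locally _ _) (x_lim v) (mkposreal _ H3)) as Hv.
    generalize (filter_and _ _ (filter_and _ _ IH Hv) (U_act 1 Rlt_0_1)).
    apply filter_imp. intros p [[A B] E] u Hu.
    destruct (Rle_lt_dec u v) as [L|L]; [apply A; lra|].
    unfold ball in B; simpl in B; unfold AbsRing_ball, abs, minus, plus, opp in B; simpl in B.
    assert (P1 : Rabs (fst p u - fst p v) <= eta / 3).
    { apply (action_holder_abs b W b0 b_cont b0_pos b_ge W_cont W_ge0 _ _ _ E h); try lra.
      rewrite Rabs_right; lra. }
    assert (P2 : Rabs (x u - x v) <= eta / 3).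
    { pose proof (limit_holder v u ltac:(lra)) as Q.
      rewrite <- (pow2_abs (x u - x v)) in Q.
      apply Rnot_lt_le. intros N. pose proof (Rabs_pos (x u - x v)). nra. }
    apply Rabs_le_between in P1. apply Rabs_le_between in P2. apply Rabs_def2 in B.
    apply Rabs_le. lra. }
(* [Rmax 0] keeps the quotient nonnegative when [t < s]. *)
destruct (nfloor_ex (Rmax 0 (t - s) / h)) as [n [_ Hn]].
{ apply Rdiv_le_0_compat; [apply Rmax_l|lra]. }
generalize (I (S n)). apply filter_imp. intros p A u Hu. apply A.
rewrite S_INR. apply (Rmult_lt_compat_r h) in Hn; [|exact h0].
unfold Rdiv in Hn. rewrite Rmult_assoc, Rinv_l, Rmult_1_r in Hn by lra.
pose proof (Rmax_r 0 (t - s)). lra.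
Qed.

Lemma limit_action : action_le b W x F c.
Proof.
split; [exact limit_Kin|]. intros s t st.
apply Rnot_lt_le. intros N.
(* A quarter of the supposed excess: the action slack, the certificate error and the potential error
   use at most [d] each. *)
set (d := (F t - F s + potential b W x s t - c) / 4).
assert (d0 : 0 < d) by (unfold d; lra).
destruct (continuous_bounded_above b s t b_cont) as [M [M0 HM]].
set (eta := d / (M * K * (t - s) + 1)).
assert (D0 : 0 <= M * K * (t - s)) by (apply Rmult_le_pos; [apply Rmult_le_pos|]; lra).
assert (eta0 : 0 < eta) by (apply Rdiv_lt_0_compat; lra).
assert (He : M * K * eta * (t - s) <= d).
{ replace (M * K * eta * (t - s)) with (d - eta) by (unfold eta; field; lra). lra. }
destruct (filter_ex _ (filter_and _ _ (filter_and _ _ (U_act d d0)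
  (limit_energy_raw s t d st d0)) (limit_uniform eta s t eta0))) as [p [[A [_ B]] D]].
pose proof (proj2 A s t st) as E.
pose proof (pot_close x (fst p) M eta s t (Kin_continuous _ _ limit_Kin)
  (Kin_continuous _ _ (proj1 A)) ltac:(lra) HM D) as P.
unfold d in *. lra.
Qed.

Lemma limit_ge (v t : R) : U (fun p => v <= fst p t) -> v <= x t.
Proof.
intros HU. change (Rbar_le (Finite v) (Finite (x t))).
apply (filterlim_le (F := U) (fun _ => v) (fun p => fst p t)); [exact HU| |apply x_lim].
apply filterlim_const.
Qed.

Lemma limit_le (v t : R) : U (fun p => fst p t <= v) -> x t <= v.
Proof.
intros HU. change (Rbar_le (Finite (x t)) (Finite v)).
apply (filterlim_le (F := U) (fun p => fst p t) (fun _ => v)); [exact HU|apply x_lim|].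
apply filterlim_const.
Qed.

End Compactness.

(** The sign conditions beyond [T] are closed under pointwise limits and prevent the transition from
    escaping to infinity. *)
Theorem action_compact (b W : R -> R) (b0 K T c : R) :
  (forall t, continuous b t) -> 0 < b0 -> (forall t, b0 <= b t) ->
  (forall p, continuous W p) -> (forall p, 0 <= W p) ->
  0 <= K -> (forall p q, Rabs (W p - W q) <= K * Rabs (p - q)) -> 0 <= c ->
  (forall d, 0 < d -> exists x F, action_le b W x F (c + d) /\ (forall t, -1 <= x t <= 1) /\
    (forall u, T < u -> 0 <= x u) /\ (forall u, u < - T -> x u <= 0)) ->
  exists x F, action_le b W x F c /\ (forall t, -1 <= x t <= 1) /\
    (forall u, T < u -> 0 <= x u) /\ (forall u, u < - T -> x u <= 0).
Proof.
intros Hb Hb0 Hge Wc W0 HK HL Hc H.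
(* These sets shrink with [d] and so generate a filter. Any refining ultrafilter has limits at every
   time, since [x] is bounded by 1 and the normalized [F] by [c + 1]. *)
set (B := fun (d : R) (p : (R -> R) * (R -> R)) =>
  action_le b W (fst p) (snd p) (c + d) /\ snd p 0 = 0 /\ (forall t, -1 <= fst p t <= 1) /\
    (forall u, T < u -> 0 <= fst p u) /\ (forall u, u < - T -> fst p u <= 0)).
assert (BP : ProperFilter (fun P => exists d, 0 < d /\ forall p, B d p -> P p)).
{ split.
  - intros P [d [d0 HP]]. destruct (H d d0) as [x [F [HE HH]]].
    exists (x, fun u => F u - F 0). apply HP. split; [|split; [simpl; ring|exact HH]].
    simpl. now apply En_shift_const.
  - split.
    + exists 1. split; [lra|auto].
    + intros P Q [d [d0 HP]] [d' [d0' HQ]]. exists (Rmin d d').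
      split; [now apply Rmin_pos|].
      intros p [HE HH]. split; [apply HP|apply HQ];
        (split; [apply En_le with (1 := HE)|exact HH]);
        pose proof (Rmin_l d d'); pose proof (Rmin_r d d'); lra.
    + intros P Q PQ [d [d0 HP]]. exists d. split; auto. }
destruct (ultrafilter_above _ BP) as [U [UP [Uu UB]]].
assert (UA : forall d, 0 < d -> U (B d)) by (intros d Hd; apply UB; eauto).
assert (UF : Filter U) by apply UP.
assert (Lx : forall t, exists l : R, filterlim (fun p : (R -> R) * (R -> R) => fst p t) U (locally l)).
{ intros t. apply (ultrafilter_bounded_lim U _ 1 UP Uu).
  generalize (UA 1 Rlt_0_1). apply filter_imp. intros p [_ [_ [Hp _]]].
  apply Rabs_le, Hp. }
assert (LF : forall t, exists l : R, filterlim (fun p : (R -> R) * (R -> R) => snd p t) U (locally l)).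
{ intros t. apply (ultrafilter_bounded_lim U _ (c + 1) UP Uu).
  generalize (UA 1 Rlt_0_1). apply filter_imp. intros p [[HKp HE] [H0 _]].
  apply Rabs_le.
  pose proof (fun s t => pot_ge0 b W b0 Hb Hb0 Hge Wc W0 _ (Kin_continuous _ _ HKp) s t) as P.
  destruct (Rtotal_order t 0) as [L|[->|L]].
  - specialize (P t 0 ltac:(lra)). specialize (HE t 0 L).
    pose proof (Kin_mono _ _ HKp t 0 ltac:(lra)). lra.
  - lra.
  - specialize (P 0 t ltac:(lra)). specialize (HE 0 t L).
    pose proof (Kin_mono _ _ HKp 0 t ltac:(lra)). lra. }
apply functional_choice in Lx. destruct Lx as [x Lx].
apply functional_choice in LF. destruct LF as [F LF].
exists x, F. split; [|split; [|split]].
- apply (limit_action b W b0 K Hb Hb0 Hge Wc W0 HK HL U UP x F c Hc Lx LF).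
  intros d d0. generalize (UA d d0). apply filter_imp. intros p [HE _]. exact HE.
- intros t. split.
  + apply (limit_ge U UP x Lx (-1) t).
    generalize (UA 1 Rlt_0_1). apply filter_imp. intros p [_ [_ [Hp _]]]. apply Hp.
  + apply (limit_le U UP x Lx 1 t).
    generalize (UA 1 Rlt_0_1). apply filter_imp. intros p [_ [_ [Hp _]]]. apply Hp.
- intros u Hu. apply (limit_ge U UP x Lx 0 u).
  generalize (UA 1 Rlt_0_1). apply filter_imp. intros p [_ [_ [_ [Hp _]]]]. now apply Hp.
- intros u Hu. apply (limit_le U UP x Lx 0 u).
  generalize (UA 1 Rlt_0_1). apply filter_imp. intros p [_ [_ [_ [_ Hp]]]]. now apply Hp.
Qed.

(** * Existence of minimizers *)

Definition clamp (p : R) : R := Rmax (-1) (Rmin 1 p).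

Lemma clamp_bound (p : R) : -1 <= clamp p <= 1.
Proof. unfold clamp, Rmax, Rmin. repeat destruct Rle_dec; lra. Qed.

Lemma clamp_id (p : R) : -1 <= p <= 1 -> clamp p = p.
Proof. unfold clamp, Rmax, Rmin. repeat destruct Rle_dec; lra. Qed.

Lemma clamp_contract (p q : R) : Rabs (clamp p - clamp q) <= Rabs (p - q).
Proof.
unfold clamp, Rmax, Rmin, Rabs.
repeat destruct Rle_dec; repeat destruct Rcase_abs; lra.
Qed.

Lemma clamp_continuous (p : R) : continuous clamp p.
Proof.
apply continuity_pt_filterlim. intros eps He. exists eps. split; [exact He|].
intros q [_ Hq]. eapply Rle_lt_trans; [apply clamp_contract|exact Hq].
Qed.

Lemma clamp_Gam (x : R -> R) : Gam x -> Gam (fun u => clamp (x u)).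
Proof.
intros [H1 H2]. split.
- rewrite <- (clamp_id (-1)) by lra. apply is_lim_comp_continuous; [exact H1|apply clamp_continuous].
- rewrite <- (clamp_id 1) by lra. apply is_lim_comp_continuous; [exact H2|apply clamp_continuous].
Qed.

(** Freeze the curve at [tau], then add two opposite hinges at [tau] and [tau + 1]: it runs linearly
    to [rho] in unit time and rests there. *)
Lemma Kin_end_right (x F : R -> R) (tau rho : R) :
  Kin x F ->
  exists y G, Kin y G /\ (forall u, u <= tau -> y u = x u /\ G u = F u) /\
    (forall u, tau + 1 <= u -> y u = rho /\ G u = F tau + (x tau - rho) ^ 2 / 2) /\
    (forall u, tau <= u -> (y u - rho) ^ 2 <= (x tau - rho) ^ 2).
Proof.
intros HK. set (m := rho - x tau).
set (y1 := fun u => x (Rmin u tau) + m * hinge tau u).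
set (G1 := fun u => F (Rmin u tau) + hinge_cost (fun u => x (Rmin u tau)) m tau u).
exists (fun u => y1 u + - m * hinge (tau + 1) u).
exists (fun u => G1 u + hinge_cost y1 (- m) (tau + 1) u).
split; [|split; [|split]].
- apply Kin_hinge, Kin_hinge. now apply Kin_stop.
- intros u Hu. unfold y1, G1. rewrite !hinge_l, !hinge_cost_l by lra.
  rewrite Rmin_left by lra. split; ring.
- intros u Hu. unfold G1. rewrite !hinge_cost_r by lra. unfold y1.
  rewrite !hinge_r by lra. rewrite !Rmin_right by lra. unfold m. split; field.
- intros u Hu. unfold y1. rewrite Rmin_right by lra. rewrite hinge_r by lra.
  destruct (Rle_lt_dec u (tau + 1)) as [L|L].
  + rewrite hinge_l by lra. unfold m.
    replace (x tau + (rho - x tau) * (u - tau) + - (rho - x tau) * 0 - rho)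
      with ((x tau - rho) * (1 - (u - tau))) by ring.
    rewrite Rpow_mult_distr. pose proof (pow2_ge_0 (x tau - rho)).
    assert ((1 - (u - tau)) ^ 2 <= 1) by nra. nra.
  + rewrite hinge_r by lra. unfold m.
    replace (x tau + (rho - x tau) * (u - tau) + - (rho - x tau) * (u - (tau + 1)) - rho)
      with 0 by ring.
    pose proof (pow2_ge_0 (x tau - rho)). lra.
Qed.

Lemma Kin_end_left (x F : R -> R) (tau rho : R) :
  Kin x F ->
  exists y G, Kin y G /\ (forall u, tau <= u -> y u = x u /\ G u = F u) /\
    (forall u, u <= tau - 1 -> y u = rho /\ G u = F tau - (x tau - rho) ^ 2 / 2) /\
    (forall u, u <= tau -> (y u - rho) ^ 2 <= (x tau - rho) ^ 2).
Proof.
intros HK.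
destruct (Kin_end_right _ _ (- tau) rho (Kin_reverse _ _ HK)) as [y [G [H1 [H2 [H3 H4]]]]].
rewrite Ropp_involutive in H3, H4.
exists (fun u => y (- u)), (fun u => - G (- u)). split; [now apply Kin_reverse|].
split; [|split].
- intros u Hu. destruct (H2 (- u) ltac:(lra)) as [-> ->]. rewrite !Ropp_involutive. auto.
- intros u Hu. destruct (H3 (- u) ltac:(lra)) as [-> ->]. split; lra.
- intros u Hu. apply H4. lra.
Qed.

Lemma Gam_pos_right (x : R -> R) (u : R) : Gam x -> exists v, u < v /\ 0 < x v.
Proof.
intros [_ H]. apply is_lim_spec in H. destruct (H (mkposreal 1 Rlt_0_1)) as [S HS].
exists (Rmax u S + 1). pose proof (Rmax_l u S). pose proof (Rmax_r u S).
split; [lra|]. specialize (HS (Rmax u S + 1) ltac:(lra)). simpl in HS.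
apply Rabs_def2 in HS. lra.
Qed.

Lemma Gam_neg_left (x : R -> R) (u : R) : Gam x -> exists v, v < u /\ x v < 0.
Proof.
intros [H _]. apply is_lim_spec in H. destruct (H (mkposreal 1 Rlt_0_1)) as [S HS].
exists (Rmin u S - 1). pose proof (Rmin_l u S). pose proof (Rmin_r u S).
split; [lra|]. specialize (HS (Rmin u S - 1) ltac:(lra)). simpl in HS.
apply Rabs_def2 in HS. lra.
Qed.

(** Turns a bound on the zeros into the sign conditions of [action_compact], by the intermediate
    value theorem. *)
Lemma Gam_sign_outside_zeros (x : R -> R) (T : R) :
  (forall t, continuous x t) -> Gam x -> (forall t, x t = 0 -> Rabs t <= T) ->
  (forall u, T < u -> 0 <= x u) /\ (forall u, u < - T -> x u <= 0).
Proof.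
intros xc G Z.
assert (xc' : continuity x) by (intros t; apply continuity_pt_filterlim, xc).
split; intros u Hu; apply Rnot_lt_le; intros N.
- destruct (Gam_pos_right x u G) as [v [uv Hv]].
  destruct (IVT x u v xc' uv N Hv) as [z [Hz E]].
  specialize (Z z E). apply Rabs_le_between in Z. lra.
- destruct (Gam_neg_left x u G) as [v [uv Hv]].
  destruct (IVT x v u xc' uv Hv N) as [z [Hz E]].
  specialize (Z z E). apply Rabs_le_between in Z. lra.
Qed.

Definition heteroclinic (b dW x : R -> R) : Prop :=
  Gam x /\ (forall t, -1 < x t < 1) /\
  exists x1, (forall u, is_derive x u (x1 u)) /\ (forall u, is_derive x1 u (b u * dW (x u))).

Section Minimization.

Context (b W dW : R -> R) (b0 C K : R).
Context (b_cont : forall t, continuous b t) (b0_pos : 0 < b0) (b_ge : forall t, b0 <= b t).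
Context (W_cont : forall p, continuous W p) (W_ge0 : forall p, 0 <= W p).
Context (W_pos : forall p, -1 < p < 1 -> 0 < W p).
Context (W_clamp : forall p, W (clamp p) = W p).
Context (W_well : forall rho q, rho = 1 \/ rho = -1 -> W q <= C * (q - rho) ^ 2).
Context (dW_cont : forall p, continuous dW p) (C_ge0 : 0 <= C).
Context (W_quad : forall p q, -1 <= p <= 1 -> W q <= W p + dW p * (q - p) + C * (q - p) ^ 2).
Context (K_ge0 : 0 <= K) (W_lip : forall p q, Rabs (W p - W q) <= K * Rabs (p - q)).
Context (dW_1 : forall p, -1 <= p <= 1 -> Rabs (dW p) <= K * Rabs (p - 1)).
Context (dW_m1 : forall p, -1 <= p <= 1 -> Rabs (dW p) <= K * Rabs (p - -1)).

(** [action_le] only bounds the action from above, so this set is upward closed; its infimum is the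
    minimal action level. *)
Definition attainable (e : R) : Prop := exists x F, Gam x /\ action_le b W x F e.

Lemma W_rest (rho : R) : rho = 1 \/ rho = -1 -> W rho = 0.
Proof. intros H. pose proof (W_well rho rho H). pose proof (W_ge0 rho). lra. Qed.

Lemma pot_near_well (y : R -> R) (rho s t r M : R) :
  rho = 1 \/ rho = -1 -> (forall u, continuous y u) -> s <= t ->
  (forall u, s < u < t -> b u <= M) -> (forall u, s < u < t -> (y u - rho) ^ 2 <= r) ->
  potential b W y s t <= M * (C * r) * (t - s).
Proof.
intros Hr yc st HM Hy.
apply (pot_upper b W b0 b_cont b0_pos b_ge W_cont W_ge0); auto.
intros u Hu. apply Rle_trans with (1 := W_well rho _ Hr).
apply Rmult_le_compat_l; auto.
Qed.

(** Ending a curve near a well is cheap: both the unit-time ramp and the potential along it cost a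
    multiple of the squared distance to the well. *)
Lemma end_right (x F : R -> R) (tau rho M e : R) :
  rho = 1 \/ rho = -1 -> Kin x F -> (forall u, tau < u < tau + 1 -> b u <= M) ->
  (forall S, S < tau -> F tau - F S + potential b W x S tau <= e) ->
  exists y G, action_le b W y G (e + (1 / 2 + M * C) * (x tau - rho) ^ 2) /\
    (forall u, u <= tau -> y u = x u) /\ (forall u, tau + 1 <= u -> y u = rho).
Proof.
intros Hr HK HM HE.
destruct (Kin_end_right x F tau rho HK) as [y [G [KG [Hl [Hr' Hm]]]]].
exists y, G. split; [|split]; [|intros; now apply Hl|intros; now apply Hr'].
apply (En_intro b W b0 b_cont b0_pos b_ge W_cont W_ge0) with (p := tau - 1) (q := tau + 1);
  [exact KG|].
intros S T HS HT ST.
pose proof (pot_Chasles b W b_cont W_cont y (Kin_continuous _ _ KG)) as Py.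
pose proof (Py S tau T) as P1. pose proof (Py tau (tau + 1) T) as P2.
rewrite (pot_ext b W y x S tau) in P1
  by (try lra; intros u Hu; f_equal; apply Hl; lra).
rewrite (pot_zero b W y (tau + 1) T) in P2.
2: lra. 2:{ intros u Hu. rewrite (proj1 (Hr' u ltac:(lra))). now apply W_rest. }
pose proof (pot_near_well y rho tau (tau + 1) ((x tau - rho) ^ 2) M Hr
  (Kin_continuous _ _ KG) ltac:(lra) HM (fun u Hu => Hm u ltac:(lra))) as P3.
specialize (HE S ltac:(lra)).
rewrite (proj2 (Hr' T HT)), (proj2 (Hl S ltac:(lra))). lra.
Qed.

Lemma end_left (x F : R -> R) (tau rho M e : R) :
  rho = 1 \/ rho = -1 -> Kin x F -> (forall u, tau - 1 < u < tau -> b u <= M) ->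
  (forall T, tau < T -> F T - F tau + potential b W x tau T <= e) ->
  exists y G, action_le b W y G (e + (1 / 2 + M * C) * (x tau - rho) ^ 2) /\
    (forall u, tau <= u -> y u = x u) /\ (forall u, u <= tau - 1 -> y u = rho).
Proof.
intros Hr HK HM HE.
destruct (Kin_end_left x F tau rho HK) as [y [G [KG [Hl [Hr' Hm]]]]].
exists y, G. split; [|split]; [|intros; now apply Hl|intros; now apply Hr'].
apply (En_intro b W b0 b_cont b0_pos b_ge W_cont W_ge0) with (p := tau - 1) (q := tau + 1);
  [exact KG|].
intros S T HS HT ST.
pose proof (pot_Chasles b W b_cont W_cont y (Kin_continuous _ _ KG)) as Py.
pose proof (Py S tau T) as P1. pose proof (Py S (tau - 1) tau) as P2.
rewrite (pot_ext b W y x tau T) in P1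
  by (try lra; intros u Hu; f_equal; apply Hl; lra).
rewrite (pot_zero b W y S (tau - 1)) in P2.
2: lra. 2:{ intros u Hu. rewrite (proj1 (Hr' u ltac:(lra))). now apply W_rest. }
pose proof (pot_near_well y rho (tau - 1) tau ((x tau - rho) ^ 2) M Hr
  (Kin_continuous _ _ KG) ltac:(lra) HM (fun u Hu => Hm u ltac:(lra))) as P3.
specialize (HE T ltac:(lra)).
rewrite (proj2 (Hr' S HS)), (proj2 (Hl T ltac:(lra))). lra.
Qed.

Lemma Gam_eventually (x : R -> R) (p q : R) :
  (forall u, u <= p -> x u = -1) -> (forall u, q <= u -> x u = 1) -> Gam x.
Proof.
intros Hp Hq. split.
- apply is_lim_ext_loc with (fun _ => -1); [|apply is_lim_const].
  exists p. intros u Hu. symmetry. apply Hp. lra.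
- apply is_lim_ext_loc with (fun _ => 1); [|apply is_lim_const].
  exists q. intros u Hu. symmetry. apply Hq. lra.
Qed.

(** Ends the constant curve -1 at the well 1; the squared distance is 4, which gives
    [4 * (1 / 2 + M * C)]. *)
Lemma attainable_ramp (M : R) :
  (forall u, 0 < u < 1 -> b u <= M) -> attainable (2 + 4 * M * C).
Proof.
intros HM.
destruct (end_right (fun _ => -1) (fun _ => 0) 0 1 M 0) as [y [G [HE [Hl Hr]]]].
- now left.
- apply Kin_const.
- intros u Hu. apply HM. lra.
- intros S HS. rewrite pot_zero; [lra|lra|]. intros u _. apply W_rest. now right.
- exists y, G. split.
  + now apply Gam_eventually with (p := 0) (q := 0 + 1).
  + apply En_le with (1 := HE). lra.
Qed.

Lemma attainable_ge0 (e : R) : attainable e -> 0 <= e.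
Proof.
intros [x [F [_ HE]]]. exact (En_ge0 b W b0 b_cont b0_pos b_ge W_cont W_ge0 x F e HE).
Qed.

Lemma attainable_inf (e0 : R) : attainable e0 ->
  exists c, 0 <= c <= e0 /\ (forall e, attainable e -> c <= e) /\
    (forall d, 0 < d -> attainable (c + d)).
Proof.
intros H0.
destruct (completeness (fun m => forall e, attainable e -> m <= e)) as [c [Hub Hl]].
- exists e0. intros m Hm. now apply Hm.
- exists 0. exact attainable_ge0.
- assert (L : forall e, attainable e -> c <= e) by (intros e He; apply Hl; intros m Hm; auto).
  exists c. split; [split|split].
  + apply Hub. exact attainable_ge0.
  + now apply L.
  + exact L.
  + intros d Hd. apply NNPP. intros N.
    assert (c + d <= c); [|lra]. apply Hub. intros e [x [F [HG HE]]].
    apply Rnot_lt_le. intros Q. apply N. exists x, F. split; [exact HG|].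
    apply En_le with (1 := HE). lra.
Qed.

(** The direct method, once zeros of near-minimizers stay in a fixed interval: the signs of the
    clamped curves give compactness, and the limit is a minimizer to which the Euler-Lagrange
    equation applies. *)
Lemma heteroclinic_of_localized (c T d : R) :
  0 <= c -> (forall e, attainable e -> c <= e) -> (forall d, 0 < d -> attainable (c + d)) ->
  0 < d ->
  (forall x F t, Gam x -> (forall u, -1 <= x u <= 1) -> action_le b W x F (c + d) ->
    x t = 0 -> Rabs t <= T) ->
  exists x, heteroclinic b dW x.
Proof.
intros c0 Hlow Happ Hd Hloc.
destruct (action_compact b W b0 K T c b_cont b0_pos b_ge W_cont W_ge0 K_ge0 W_lip c0)
  as [x [F [HE [bd [HR HL]]]]].
{ intros d' Hd'. destruct (Happ (Rmin d d')) as [x [F [HG HE]]]; [now apply Rmin_pos|].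
  pose proof (Rmin_l d d'). pose proof (Rmin_r d d').
  pose proof (En_contract b W clamp x F _ clamp_contract W_clamp HE) as HE'.
  exists (fun u => clamp (x u)), F. split; [apply En_le with (1 := HE'); lra|].
  split; [intros; apply clamp_bound|].
  apply Gam_sign_outside_zeros; [exact (Kin_continuous _ _ (proj1 HE'))|now apply clamp_Gam|].
  intros t Ht. apply (Hloc (fun u => clamp (x u)) F t); auto.
  - now apply clamp_Gam.
  - intros u. apply clamp_bound.
  - apply En_le with (1 := HE'). lra. }
assert (G : Gam x) by exact (sided_Gam b W x F b0 c T b_cont b0_pos b_ge W_cont W_ge0 W_pos HE bd HR HL).
destruct (Euler_Lagrange b W dW b0 C b_cont b0_pos b_ge W_cont W_ge0 dW_cont W_quad x F c G bd HE)
  as [x1 [H1 H2]].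
{ intros y H e Gy HyE. apply Hlow. now exists y, H. }
exists x. split; [exact G|split].
- apply (heteroclinic_strict b dW x x1 K); auto.
  intros t. specialize (b_ge t). lra.
- now exists x1.
Qed.

(** After a zero the curve stays in [[-1/2, 1/2]] for a time [d]. Where [b] is at least [B] this
    costs [e + 1], so zeros cannot lie far out. *)
Lemma heteroclinic_of_coercive :
  (forall B, exists S, forall t, S <= Rabs t -> B <= b t) -> exists x, heteroclinic b dW x.
Proof.
intros Hco.
destruct (continuous_bounded_above b 0 1 b_cont) as [M [M0 HM]].
destruct (attainable_inf _ (attainable_ramp M (fun u Hu => HM u ltac:(lra))))
  as [c [[c0 _] [Hlow Happ]]].
destruct (double_well_lower W (1 / 2) W_cont W_pos ltac:(lra)) as [w [w0 Hw]].
set (e := c + 1). set (d := / (8 * e)).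
assert (e0 : 0 < e) by (unfold e; lra).
assert (d0 : 0 < d) by (apply Rinv_0_lt_compat; lra).
assert (Hd : 8 * e * d = 1) by (unfold d; field; lra).
set (B := (e + 1) / (w * d)).
assert (wd : 0 < w * d) by (apply Rmult_lt_0_compat; assumption).
assert (B0 : 0 < B) by (apply Rdiv_lt_0_compat; lra).
assert (HB : B * w * d = e + 1) by (unfold B; field; lra).
destruct (Hco B) as [S HS].
(* The extra [d] keeps the whole window [[t, t + d]] in the region where [b] is large. *)
apply (heteroclinic_of_localized c (S + d) 1 c0 Hlow Happ Rlt_0_1).
intros x F t G bd HE Ht. fold e in HE.
apply Rnot_lt_le. intros N.
assert (P : B * w * (t + d - t) <= potential b W x t (t + d)).
{ apply pot_lower; auto; try lra.
  - exact (Kin_continuous _ _ (proj1 HE)).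
  - intros u Hu. apply HS.
    pose proof (Rabs_triang u (t - u)) as Tr. replace (u + (t - u)) with t in Tr by ring.
    rewrite (Rabs_left1 (t - u)) in Tr by lra. lra.
  - intros u Hu. apply Hw.
    apply (dip_stays b W b0 b_cont b0_pos b_ge W_cont W_ge0 x F e HE d 1 t u); try lra.
    + rewrite Ht, Rabs_R0. lra.
    + rewrite Rabs_right; lra. }
pose proof (En_pot b W b0 b_cont b0_pos b_ge W_cont W_ge0 x F e t (t + d) HE ltac:(lra)).
replace (t + d - t) with d in P by ring. lra.
Qed.

Lemma pot_compare (b' x : R -> R) (r q s t : R) :
  (forall u, continuous b' u) -> (forall u, continuous x u) -> s <= t ->
  (forall u, s < u < t -> b' u * W (x u) <= r * (b u * W (x u)) - q) ->
  potential b' W x s t <= r * potential b W x s t - q * (t - s).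
Proof.
intros Hb' xc st H.
replace (r * potential b W x s t - q * (t - s))
  with (RInt (fun u => r * (b u * W (x u)) - q) s t).
- apply RInt_le; auto.
  + now apply pot_ex.
  + apply (ex_RInt_minus (V := R_NormedModule)); [|apply ex_RInt_const].
    apply (ex_RInt_scal (V := R_NormedModule)). now apply pot_ex.
- apply is_RInt_unique. apply (is_RInt_minus (V := R_NormedModule)).
  + apply (is_RInt_scal (V := R_NormedModule)), (RInt_correct (fun u => b u * W (x u))).
    now apply pot_ex.
  + replace (q * (t - s)) with (scal (t - s) q) by (unfold scal; simpl; unfold mult; simpl; ring).
    apply (is_RInt_const (V := R_NormedModule)).
Qed.

Lemma pot_shift (x : R -> R) (k s t : R) :
  (forall u, continuous x u) ->
  potential b W (fun u => x (u + k)) s t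
  = potential (fun u => b (u - k)) W x (s + k) (t + k).
Proof.
intros xc. unfold potential.
replace (s + k) with (1 * s + k) by ring. replace (t + k) with (1 * t + k) by ring.
rewrite <- (RInt_comp_lin (V := R_CompleteNormedModule) (fun u => b (u - k) * W (x u))).
- apply RInt_ext. intros u _. unfold scal; simpl; unfold mult; simpl.
  rewrite !Rmult_1_l. replace (u + k - k) with u by ring. reflexivity.
- apply (pot_ex (fun u => b (u - k)) W); auto.
  intros u. apply (continuous_comp (fun u => u - k) b); [|apply b_cont].
  apply (continuous_minus (fun u : R => u) (fun _ => k));
    [apply continuous_id|apply continuous_const].
Qed.

(** Avoiding both wells throughout a time [L] would cost more than [e]. *)
Lemma well_visit (x F : R -> R) (e eta w L s : R) :
  action_le b W x F e -> 0 <= w -> (forall p, Rabs p <= 1 - eta -> w <= W p) ->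
  0 <= L -> e < b0 * w * L -> exists tau, s <= tau <= s + L /\ 1 - eta < Rabs (x tau).
Proof.
intros HE w0 Hw HL He. apply NNPP. intros N.
assert (P : b0 * w * (s + L - s) <= potential b W x s (s + L)).
{ apply pot_lower; auto; try lra.
  - exact (Kin_continuous _ _ (proj1 HE)).
  - intros u Hu. apply Hw. apply Rnot_lt_le. intros Q. apply N. exists u. split; [lra|exact Q]. }
pose proof (En_pot b W b0 b_cont b0_pos b_ge W_cont W_ge0 x F e s (s + L) HE ltac:(lra)).
replace (s + L - s) with L in P by ring. lra.
Qed.

Lemma window_cost (x F : R -> R) (e w d t0 s : R) :
  action_le b W x F e -> 0 <= w -> (forall p, Rabs p <= 1 / 2 -> w <= W p) ->
  0 <= d -> 8 * e * d <= 1 -> x t0 = 0 -> t0 - d <= s <= t0 ->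
  b0 * w * d <= potential b W x s (s + d).
Proof.
intros HE w0 Hw d0 Hd Ht0 Hs.
replace (b0 * w * d) with (b0 * w * (s + d - s)) by ring.
apply pot_lower; auto; try lra.
- exact (Kin_continuous _ _ (proj1 HE)).
- intros u Hu. apply Hw.
  replace (1 / 2) with (1 - 1 / 2) by lra.
  apply (dip_stays b W b0 b_cont b0_pos b_ge W_cont W_ge0 x F e HE d 1 t0 u); try lra.
  + rewrite Ht0, Rabs_R0. lra.
  + apply Rabs_le. lra.
Qed.

(* Around a far-away zero, a near-minimizer makes a single transition; translating it by [k]
   to where [b] is smaller would beat the infimum. *)
Lemma heteroclinic_of_shift (M m e d w eta we L g theta T : R) :
  (forall u, b u <= M) -> e = 3 + 4 * M * C -> 0 < m ->
  0 < d -> 8 * e * d <= 1 ->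
  0 < w -> (forall p, Rabs p <= 1 / 2 -> w <= W p) ->
  0 < eta <= 1 / 2 -> 0 < we -> (forall p, Rabs p <= 1 - eta -> we <= W p) ->
  0 < L -> e < b0 * we * L ->
  (1 / 2 + M * C) * eta ^ 2 <= g -> 0 < g <= 1 / 4 ->
  4 * g <= b0 * w * d -> 5 * g <= m * w * d ->
  0 <= theta -> theta * e <= g ->
  (forall t0, T < Rabs t0 -> exists k,
     (forall u, t0 <= u <= t0 + d -> b (u - k) <= b u - m) /\
     (forall u, t0 - L - 1 <= u <= t0 + L + 1 -> b (u - k) <= (1 + theta) * b u)) ->
  exists x, heteroclinic b dW x.
Proof.
intros HM Ee m0 d0 Hd w0 Hw He we0 Hwe L0 HL Hg g0 Hg1 Hg2 th0 Hth Hshift.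
destruct (attainable_inf _ (attainable_ramp M (fun u _ => HM u)))
  as [c [[c0 c1] [Hlow Happ]]].
apply (heteroclinic_of_localized c T g c0 Hlow Happ (proj1 g0)).
intros x F t0 G bd HE0 Ht0. apply Rnot_lt_le. intros Far.
assert (xc : forall u, continuous x u) by exact (Kin_continuous _ _ (proj1 HE0)).
(* [e] exceeds the ramp bound by 1, which leaves room for the slack [g] here and [3 * g] later. *)
assert (HE : action_le b W x F e) by (apply En_le with (1 := HE0); lra).
assert (M0 : 0 <= M) by (specialize (HM 0); specialize (b_ge 0); lra).
assert (near : forall tau rho, (x tau - rho) ^ 2 <= eta ^ 2 ->
  (1 / 2 + M * C) * (x tau - rho) ^ 2 <= g).
{ intros tau rho H. apply Rle_trans with (2 := Hg). apply Rmult_le_compat_l; [|exact H].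
  assert (0 <= M * C) by (apply Rmult_le_pos; lra). lra. }
(* Near [t0] the curve stays in [[-1/2, 1/2]], so visits to the wells fall outside the windows of
   length [d] on either side of [t0]. *)
assert (apart : forall tau, 1 - eta < Rabs (x tau) -> d < Rabs (tau - t0)).
{ intros tau H. apply Rnot_le_lt. intros N.
  assert (Rabs (x tau) <= 1 - 1 / 2); [|lra].
  apply (dip_stays b W b0 b_cont b0_pos b_ge W_cont W_ge0 x F e HE d 1 t0 tau); try lra.
  rewrite Ht0, Rabs_R0. lra. }
destruct (well_visit x F e eta we L (t0 - L) HE ltac:(lra) Hwe ltac:(lra) HL)
  as [t1 [Ht1 V1]].
destruct (well_visit x F e eta we L t0 HE ltac:(lra) Hwe ltac:(lra) HL)
  as [t2 [Ht2 V2]].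
pose proof (apart t1 V1) as A1. rewrite Rabs_left1 in A1 by lra.
pose proof (apart t2 V2) as A2. rewrite Rabs_right in A2 by lra.
pose proof (window_cost x F e w d t0 (t0 - d) HE ltac:(lra) Hw ltac:(lra) Hd Ht0 ltac:(lra)) as Wl.
pose proof (window_cost x F e w d t0 t0 HE ltac:(lra) Hw ltac:(lra) Hd Ht0 ltac:(lra)) as Wr.
pose proof (pot_Chasles b W b_cont W_cont x xc) as Px.
pose proof (fun r s t v => pot_sub b W b0 b_cont b0_pos b_ge W_cont W_ge0 x xc r s t v) as Psub.
pose proof (Kin_mono _ _ (proj1 HE)) as Fm.
(* If [x] is already near 1 at [t1], ending it there drops the window left of [t0]: at least [4 * g]
   is saved against a cutting cost and a slack of [g] each. *)
destruct (Rle_lt_dec 0 (x t1)) as [s1|s1].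
{ rewrite Rabs_right in V1 by lra.
  destruct (end_right x F t1 1 M (c + g - b0 * w * d)) as [y [H [Ey [Yl Yr]]]];
    [now left|apply HE|auto| |].
  { intros S HS. pose proof (proj2 HE0 S t0 ltac:(lra)). pose proof (Fm t1 t0 ltac:(lra)).
    pose proof (Px S t1 t0). pose proof (Psub t1 (t0 - d) (t0 - d + d) t0 ltac:(lra) ltac:(lra)).
    lra. }
  assert (q1 : (x t1 - 1) ^ 2 <= eta ^ 2) by (specialize (bd t1); nra).
  specialize (near t1 1 q1).
  enough (c <= c + g - b0 * w * d + (1 / 2 + M * C) * (x t1 - 1) ^ 2) by lra.
  apply Hlow. exists y, H. split; [split|exact Ey].
  - apply is_lim_ext_loc with (2 := proj1 G). exists t1. intros u Hu. symmetry. apply Yl. lra.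
  - apply is_lim_ext_loc with (fun _ => 1); [|apply is_lim_const].
    exists (t1 + 1). intros u Hu. symmetry. apply Yr. lra. }
rewrite Rabs_left in V1 by lra.
(* Symmetrically, if [x] is still near -1 at [t2], starting there drops the window right of [t0]. *)
destruct (Rle_lt_dec (x t2) 0) as [s2|s2].
{ rewrite Rabs_left1 in V2 by lra.
  destruct (end_left x F t2 (-1) M (c + g - b0 * w * d)) as [y [H [Ey [Yr Yl]]]];
    [now right|apply HE|auto| |].
  { intros S HS. pose proof (proj2 HE0 t0 S ltac:(lra)). pose proof (Fm t0 t2 ltac:(lra)).
    pose proof (Px t0 t2 S). pose proof (Psub t0 t0 (t0 + d) t2 ltac:(lra) ltac:(lra)).
    lra. }
  assert (q2 : (x t2 - -1) ^ 2 <= eta ^ 2) by (specialize (bd t2); nra).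
  specialize (near t2 (-1) q2).
  enough (c <= c + g - b0 * w * d + (1 / 2 + M * C) * (x t2 - -1) ^ 2) by lra.
  apply Hlow. exists y, H. split; [split|exact Ey].
  - apply is_lim_ext_loc with (fun _ => -1); [|apply is_lim_const].
    exists (t2 - 1). intros u Hu. symmetry. apply Yl. lra.
  - apply is_lim_ext_loc with (2 := proj2 G). exists t2. intros u Hu. symmetry. apply Yr. lra. }
rewrite Rabs_right in V2 by lra.
(* Now [x] is near -1 at [t1] and near 1 at [t2]. Cutting at both ends confines the transition to
   [[t0 - L - 1, t0 + L + 1]] at action at most [c + 3 * g]. *)
destruct (end_left x F t1 (-1) M (c + g)) as [y [H [Ey [Yr Yl]]]];
  [now right|apply HE|auto|intros S HS; now apply HE0|].
assert (q1 : (x t1 - -1) ^ 2 <= eta ^ 2) by (specialize (bd t1); nra).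
pose proof (near t1 (-1) q1) as n1.
destruct (end_right y H t2 1 M _ ltac:(now left) (proj1 Ey) (fun u _ => HM u)
  (fun S HS => proj2 Ey S t2 HS)) as [z [I [Ez [Zl Zr]]]].
assert (q2 : (x t2 - 1) ^ 2 <= eta ^ 2) by (specialize (bd t2); nra).
pose proof (near t2 1 q2) as n2.
rewrite (Yr t2) in Ez by lra.
assert (Ez' : action_le b W z I (c + 3 * g)) by (apply En_le with (1 := Ez); lra).
assert (Ez2 : action_le b W z I e) by (apply En_le with (1 := Ez'); lra).
assert (Z0 : z t0 = 0) by (rewrite Zl, Yr by lra; exact Ht0).
assert (zl : forall u, u <= t0 - L - 1 -> z u = -1) by (intros u Hu; rewrite Zl, Yl by lra; reflexivity).
assert (zr : forall u, t0 + L + 1 <= u -> z u = 1) by (intros u Hu; apply Zr; lra).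
assert (zc : forall u, continuous z u) by exact (Kin_continuous _ _ (proj1 Ez)).
destruct (Hshift t0 Far) as [k [K1 K2]].
set (b' := fun u => b (u - k)).
assert (b'c : forall u, continuous b' u).
{ intros u. apply (continuous_comp (fun u => u - k) b); [|apply b_cont].
  apply (continuous_minus (fun u : R => u) (fun _ => k));
    [apply continuous_id|apply continuous_const]. }
assert (Cmp : forall u, b' u * W (z u) <= (1 + theta) * (b u * W (z u)) - 0).
{ intros u. rewrite Rminus_0_r.
  destruct (Rle_lt_dec u (t0 - L - 1)) as [l1|l1];
    [rewrite zl, W_rest by auto; lra|].
  destruct (Rle_lt_dec (t0 + L + 1) u) as [l2|l2];
    [rewrite zr, W_rest by auto; lra|].
  rewrite <- Rmult_assoc. apply Rmult_le_compat_r; [apply W_ge0|]. apply K2. lra. }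
assert (Cmw : forall u, t0 < u < t0 + d ->
  b' u * W (z u) <= (1 + theta) * (b u * W (z u)) - m * w).
{ intros u Hu. specialize (K1 u ltac:(lra)).
  assert (hw : w <= W (z u)).
  { apply Hw. replace (1 / 2) with (1 - 1 / 2) by lra.
    apply (dip_stays b W b0 b_cont b0_pos b_ge W_cont W_ge0 z I e Ez2 d 1 t0 u); try lra.
    - rewrite Z0, Rabs_R0. lra.
    - rewrite Rabs_right; lra. }
  assert (b' u * W (z u) <= (b u - m) * W (z u))
    by (apply Rmult_le_compat_r; [lra|exact K1]).
  assert (0 <= theta * (b u * W (z u)))
    by (apply Rmult_le_pos; [lra|apply Rmult_le_pos; [specialize (b_ge u)|]; lra]).
  nra. }
(* Translation may cost [theta * e], at most [g], but gains [m * w * d], at least [5 * g], on the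
   window after [t0]. *)
enough (c <= c + 3 * g + theta * e - m * w * d) by lra.
apply Hlow. exists (fun u => z (u + k)), (fun u => I (u + k)). split.
- apply Gam_eventually with (p := t0 - L - 1 - k) (q := t0 + L + 1 - k).
  + intros u Hu. apply zl. lra.
  + intros u Hu. apply zr. lra.
- apply (En_intro b W b0 b_cont b0_pos b_ge W_cont W_ge0) with (p := t0 - k) (q := t0 + d - k).
  { apply Kin_shift, Ez. }
  intros S T' HS HT ST. rewrite (pot_shift z k S T' zc). fold b'.
  pose proof (pot_Chasles b' W b'c W_cont z zc) as Pb'.
  pose proof (pot_Chasles b W b_cont W_cont z zc) as Pz.
  pose proof (Pb' (S + k) t0 (T' + k)). pose proof (Pb' t0 (t0 + d) (T' + k)).
  pose proof (Pz (S + k) t0 (T' + k)). pose proof (Pz t0 (t0 + d) (T' + k)).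
  pose proof (pot_compare b' z (1 + theta) 0 (S + k) t0 b'c zc ltac:(lra) (fun u _ => Cmp u)).
  pose proof (pot_compare b' z (1 + theta) (m * w) t0 (t0 + d) b'c zc ltac:(lra) Cmw).
  pose proof (pot_compare b' z (1 + theta) 0 (t0 + d) (T' + k) b'c zc ltac:(lra) (fun u _ => Cmp u)).
  pose proof (proj2 Ez' (S + k) (T' + k) ltac:(lra)).
  pose proof (En_pot b W b0 b_cont b0_pos b_ge W_cont W_ge0 z I e (S + k) (T' + k) Ez2 ltac:(lra)).
  assert (theta * potential b W z (S + k) (T' + k) <= theta * e)
    by (apply Rmult_le_compat_l; assumption).
  assert (Ez3 : potential b W z (S + k) (T' + k) = potential b W z (S + k) t0
    + (potential b W z t0 (t0 + d) + potential b W z (t0 + d) (T' + k))) by lra.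
  rewrite Ez3 in *. replace (t0 + d - t0) with d in * by ring.
  cbv beta. lra.
Qed.

End Minimization.

(** * The truncated potential and the hypotheses on the coefficient *)

(** Fixes [d], [L] and [theta] from the bounds [b0], [M] and the gap [m] alone, before [b] is given.
    This order lets the threshold on [eps] depend on [L], and the asymptotic error on [theta]. *)
Lemma heteroclinic_of_uniform_shift (W dW : R -> R) (C K b0 M : R) :
  (forall p, continuous W p) -> (forall p, 0 <= W p) ->
  (forall p, -1 < p < 1 -> 0 < W p) -> (forall p, W (clamp p) = W p) ->
  (forall rho q, rho = 1 \/ rho = -1 -> W q <= C * (q - rho) ^ 2) ->
  (forall p, continuous dW p) -> 0 <= C ->
  (forall p q, -1 <= p <= 1 -> W q <= W p + dW p * (q - p) + C * (q - p) ^ 2) ->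
  0 <= K -> (forall p q, Rabs (W p - W q) <= K * Rabs (p - q)) ->
  (forall p, -1 <= p <= 1 -> Rabs (dW p) <= K * Rabs (p - 1)) ->
  (forall p, -1 <= p <= 1 -> Rabs (dW p) <= K * Rabs (p - -1)) ->
  0 < b0 -> 0 <= M -> forall m, 0 < m ->
  exists d L theta, 0 < d <= 1 /\ 0 < L /\ 0 < theta /\
    forall b T, (forall t, continuous b t) -> (forall t, b0 <= b t <= M) ->
    (forall t0, T < Rabs t0 -> exists k,
       (forall u, t0 <= u <= t0 + d -> b (u - k) <= b u - m) /\
       (forall u, t0 - L - 1 <= u <= t0 + L + 1 -> b (u - k) <= (1 + theta) * b u)) ->
    exists x, heteroclinic b dW x.
Proof.
intros Wc W0 Wp Wcl Ww dWc C0 Wq K0 Wl D1 D2 b0p M0 m m0.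
assert (MC : 0 <= M * C) by (apply Rmult_le_pos; assumption).
set (e := 3 + 4 * M * C). assert (e0 : 3 <= e) by (unfold e; lra).
set (d := / (8 * e)).
assert (d0 : 0 < d) by (apply Rinv_0_lt_compat; lra).
assert (Hd : 8 * e * d = 1) by (unfold d; field; lra).
assert (d1 : d <= 1) by nra.
destruct (double_well_lower W (1 / 2) Wc Wp ltac:(lra)) as [w [w0 Hw]].
assert (wd0 : 0 < w * d) by (apply Rmult_lt_0_compat; assumption).
(* The unit of loss: small against the cost of a window and against the gain from translation. *)
set (g := Rmin (1 / 4) (Rmin (b0 * (w * d) / 4) (m * (w * d) / 5))).
assert (g0 : 0 < g).
{ assert (0 < b0 * (w * d)) by now apply Rmult_lt_0_compat.
  assert (0 < m * (w * d)) by now apply Rmult_lt_0_compat.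
  repeat apply Rmin_pos; lra. }
assert (g1 : g <= 1 / 4) by apply Rmin_l.
assert (g23 : g <= Rmin (b0 * (w * d) / 4) (m * (w * d) / 5)) by apply Rmin_r.
pose proof (Rmin_l (b0 * (w * d) / 4) (m * (w * d) / 5)) as g2.
pose proof (Rmin_r (b0 * (w * d) / 4) (m * (w * d) / 5)) as g3.
(* Since [eta <= 1 / 2] gives [eta ^ 2 <= eta], the bound [eta <= q] suffices and no square root is
   needed. *)
set (q := g / (1 / 2 + M * C)).
assert (q0 : 0 < q) by (apply Rdiv_lt_0_compat; lra).
set (eta := Rmin (1 / 2) q).
assert (eta0 : 0 < eta) by (apply Rmin_pos; lra).
assert (eta1 : eta <= 1 / 2) by apply Rmin_l.
assert (eta2 : (1 / 2 + M * C) * eta ^ 2 <= g).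
{ assert (eta <= q) by apply Rmin_r.
  replace g with ((1 / 2 + M * C) * q) by (unfold q; field; lra).
  apply Rmult_le_compat_l; nra. }
destruct (double_well_lower W eta Wc Wp ltac:(lra)) as [we [we0 Hwe]].
assert (bwe : 0 < b0 * we) by (apply Rmult_lt_0_compat; assumption).
exists d, ((e + 1) / (b0 * we)), (g / e).
assert (L0 : 0 < (e + 1) / (b0 * we)) by (apply Rdiv_lt_0_compat; lra).
assert (th0 : 0 < g / e) by (apply Rdiv_lt_0_compat; lra).
repeat split; try assumption.
intros b T bc bb Hs.
apply (heteroclinic_of_shift b W dW b0 C K) with (M := M) (m := m) (e := e) (d := d) (w := w)
  (eta := eta) (we := we) (L := (e + 1) / (b0 * we)) (g := g) (theta := g / e) (T := T); auto;
  try lra; try (intros; apply bb).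
- intros p Hp. apply Hw. lra.
- replace (b0 * we * ((e + 1) / (b0 * we))) with (e + 1); [lra|].
  field. apply Rgt_not_eq in we0, b0p. auto.
- apply Req_le. field. lra.
Qed.

Section TruncatedWell.

Context (V : R -> R) (V_C2 : C2 V) (V_ge0 : forall x, 0 <= V x).
Context (V_m1 : V (-1) = 0) (V_1 : V 1 = 0) (V_pos : forall x, -1 < x < 1 -> 0 < V x).

(* Freezing [V] outside [-1, 1] lets the perturbations of a minimizer leave that interval. *)
Definition well (p : R) : R := V (clamp p).
Definition dwell (p : R) : R := Derive V (clamp p).

Lemma V_is_derive (p : R) : is_derive V p (Derive V p).
Proof. apply Derive_correct, V_C2. Qed.

Lemma well_continuous (p : R) : continuous well p.
Proof.
apply (continuous_comp clamp V); [apply clamp_continuous|].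
apply (ex_derive_continuous V), V_C2.
Qed.

Lemma dwell_continuous (p : R) : continuous dwell p.
Proof.
apply (continuous_comp clamp (Derive V)); [apply clamp_continuous|].
apply (ex_derive_continuous (Derive V)), V_C2.
Qed.

Lemma well_pos (p : R) : -1 < p < 1 -> 0 < well p.
Proof. intros H. unfold well. rewrite clamp_id by lra. now apply V_pos. Qed.

Lemma well_clamp (p : R) : well (clamp p) = well p.
Proof. unfold well. now rewrite (clamp_id (clamp p)) by apply clamp_bound. Qed.

Lemma dV_rest (rho : R) : rho = 1 \/ rho = -1 -> Derive V rho = 0.
Proof.
intros H. apply (is_derive_extremum V rho _ (V_is_derive rho)). right. intros u.
destruct H as [-> | ->]; rewrite ?V_1, ?V_m1; apply V_ge0.
Qed.

Lemma dV_lipschitz : exists K, 0 < K /\ forall p q, -1 <= p <= 1 -> -1 <= q <= 1 ->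
  Rabs (Derive V p - Derive V q) <= K * Rabs (p - q).
Proof.
destruct (continuous_bounded_above (fun u => Rabs (Derive_n V 2 u)) (-1) 1) as [K [K0 HK]].
{ intros t. apply (continuous_comp (Derive_n V 2) Rabs); [apply V_C2|apply continuous_Rabs]. }
exists K. split; [exact K0|]. intros p q Hp Hq.
destruct (MVT_gen (Derive V) q p (Derive_n V 2)) as [xi [Hxi E]].
- intros u _. apply Derive_correct, V_C2.
- intros u _. apply continuity_pt_filterlim, (ex_derive_continuous (Derive V)), V_C2.
- rewrite E, Rabs_mult. apply Rmult_le_compat_r; [apply Rabs_pos|]. apply HK.
  revert Hxi. unfold Rmin, Rmax. destruct Rle_dec; lra.
Qed.

Lemma V_mean_value (p q : R) : exists xi, Rmin p q <= xi <= Rmax p q /\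
  V q - V p = Derive V xi * (q - p).
Proof.
apply MVT_gen.
- intros u _. apply V_is_derive.
- intros u _. apply continuity_pt_filterlim, (ex_derive_continuous V), V_C2.
Qed.

(** With [K] a Lipschitz constant of [V'], the factor 2 serves twice: points of [[-1, 1]] lie within
    2 of a well, and the quadratic bound pays [K] for Taylor's remainder and [K] for clamping
    [q]. *)
Lemma well_estimates : exists K, 0 <= K /\
  (forall p q, Rabs (well p - well q) <= K * Rabs (p - q)) /\
  (forall p q, -1 <= p <= 1 -> well q <= well p + dwell p * (q - p) + K * (q - p) ^ 2) /\
  (forall rho p, rho = 1 \/ rho = -1 -> -1 <= p <= 1 -> Rabs (dwell p) <= K * Rabs (p - rho)).
Proof.
destruct dV_lipschitz as [K [K0 HK]]. exists (2 * K).
assert (B : forall rho p, rho = 1 \/ rho = -1 -> -1 <= p <= 1 ->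
  Rabs (Derive V p) <= K * Rabs (p - rho)).
{ intros rho p Hr Hp. specialize (HK p rho Hp ltac:(lra)).
  rewrite (dV_rest rho Hr), Rminus_0_r in HK. exact HK. }
split; [lra|split; [|split]].
- intros p q. unfold well.
  pose proof (clamp_bound p) as Bp. pose proof (clamp_bound q) as Bq.
  destruct (V_mean_value (clamp q) (clamp p)) as [xi [Hxi E]].
  rewrite E, Rabs_mult. apply Rmult_le_compat; try apply Rabs_pos; [|apply clamp_contract].
  assert (X : -1 <= xi <= 1) by (revert Hxi; unfold Rmin, Rmax; destruct Rle_dec; lra).
  apply Rle_trans with (1 := B 1 xi (or_introl eq_refl) X).
  rewrite Rabs_left1 by lra. nra.
- intros p q Hp. unfold well, dwell. rewrite (clamp_id p Hp).
  pose proof (clamp_bound q) as Bq.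
  destruct (V_mean_value p (clamp q)) as [xi [Hxi E]].
  assert (X : -1 <= xi <= 1) by (revert Hxi; unfold Rmin, Rmax; destruct Rle_dec; lra).
  assert (Cq : Rabs (clamp q - p) <= Rabs (q - p)).
  { rewrite <- (clamp_id p Hp) at 1. apply clamp_contract. }
  assert (T1 : (Derive V xi - Derive V p) * (clamp q - p) <= K * (q - p) ^ 2).
  { apply Rle_trans with (1 := Rle_abs _). rewrite Rabs_mult, <- (pow2_abs (q - p)).
    assert (Rabs (Derive V xi - Derive V p) <= K * Rabs (q - p)).
    { apply Rle_trans with (1 := HK xi p X Hp). apply Rmult_le_compat_l; [lra|].
      apply Rle_trans with (2 := Cq).
      revert Hxi. unfold Rmin, Rmax, Rabs. destruct Rle_dec; repeat destruct Rcase_abs; lra. }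
    replace (K * Rabs (q - p) ^ 2) with (K * Rabs (q - p) * Rabs (q - p)) by ring.
    apply Rmult_le_compat; auto using Rabs_pos. }
  (* Clamping only matters when it hits a rest point, where V' vanishes. *)
  assert (T2 : Derive V p * (clamp q - q) <= K * (q - p) ^ 2).
  { destruct (Req_dec (clamp q) q) as [Eq|Nq].
    { rewrite Eq, Rminus_diag, Rmult_0_r. apply Rmult_le_pos; [lra|apply pow2_ge_0]. }
    assert (Hr : clamp q = 1 /\ 1 < q \/ clamp q = -1 /\ q < -1).
    { revert Nq. unfold clamp, Rmax, Rmin. repeat destruct Rle_dec; lra. }
    apply Rle_trans with (1 := Rle_abs _). rewrite Rabs_mult, <- (pow2_abs (q - p)).
    replace (K * Rabs (q - p) ^ 2) with (K * Rabs (q - p) * Rabs (q - p)) by ring.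
    apply Rmult_le_compat; try apply Rabs_pos.
    - apply Rle_trans with (1 := B (clamp q) p ltac:(lra) Hp).
      apply Rmult_le_compat_l; [lra|]. rewrite Rabs_minus_sym. exact Cq.
    - destruct Hr as [[-> Q]|[-> Q]]; unfold Rabs; repeat destruct Rcase_abs; lra. }
  replace (V (clamp q)) with (V p + Derive V xi * (clamp q - p)) by lra. lra.
- intros rho p Hr Hp. unfold dwell. rewrite (clamp_id p Hp).
  apply Rle_trans with (1 := B rho p Hr Hp). pose proof (Rabs_pos (p - rho)). nra.
Qed.

(** The strict bounds make the truncation invisible along [x], and continuity of the right-hand side
    gives the [C2] regularity. *)
Lemma heteroclinic_solves (a x : R -> R) (eps : R) :
  (forall t, continuous a t) -> heteroclinic (fun t => a (eps * t)) dwell x ->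
  C2 x /\ solves_P V a eps x /\ (forall t, -1 < x t < 1).
Proof.
intros Ha [[G1 G2] [bd [x1 [H1 H2]]]].
assert (E1 : forall t, Derive x t = x1 t) by (intros t; apply is_derive_unique, H1).
assert (D2 : forall t, is_derive (Derive x) t (a (eps * t) * dwell (x t))).
{ intros t. apply is_derive_ext with (2 := H2 t). intros u. now rewrite E1. }
assert (E2 : forall t, Derive_n x 2 t = a (eps * t) * dwell (x t))
  by (intros t; apply is_derive_unique, D2).
split; [split; [|split]|split; [split; [|split]|]]; auto.
- intros t. eexists. apply H1.
- intros t. eexists. apply D2.
- intros t. apply continuous_ext with (f := fun t => a (eps * t) * dwell (x t)).
  { intros u. now rewrite E2. }
  apply (continuous_mult (fun t => a (eps * t)) (fun t => dwell (x t))).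
  + apply (continuous_comp (fun t => eps * t) a); [|apply Ha].
    apply (continuous_scal_r eps (fun t : R => t)), continuous_id.
  + apply (continuous_comp x dwell); [|apply dwell_continuous].
    apply (ex_derive_continuous x). eexists. apply H1.
- intros t. rewrite E2. unfold dwell. rewrite clamp_id; [reflexivity|].
  specialize (bd t). lra.
Qed.

End TruncatedWell.

(** * Periods, infima and limits of the coefficient *)

Lemma periodic_multiple (f : R -> R) (P : R) :
  (forall t, f (t + P) = f t) -> forall (z : Z) t, f (t + IZR z * P) = f t.
Proof.
intros HP.
assert (N : forall (n : nat) t, f (t + INR n * P) = f t).
{ induction n as [|n IH]; intros t.
  - f_equal. simpl. ring.
  - rewrite S_INR. replace (t + (INR n + 1) * P) with (t + INR n * P + P) by ring.
    rewrite HP. apply IH. }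
intros z t. destruct (Z_le_dec 0 z) as [L|L].
- rewrite <- (Z2Nat.id z L), <- INR_IZR_INZ. apply N.
- rewrite <- (N (Z.to_nat (- z)) (t + IZR z * P)). f_equal.
  rewrite INR_IZR_INZ, Z2Nat.id, opp_IZR by lia. ring.
Qed.

Lemma period_reduction (P t : R) : 0 < P -> exists z : Z, 0 <= t - IZR z * P <= P.
Proof.
intros HP. destruct (floor_ex (t / P)) as [z Hz]. exists z.
assert (E : t = t / P * P) by (field; lra).
assert (IZR z * P <= t / P * P) by (apply Rmult_le_compat_r; lra).
assert (t / P * P <= (IZR z + 1) * P) by (apply Rmult_le_compat_r; lra). lra.
Qed.

Lemma inf_pos_bound (a : R -> R) : inf_pos a -> exists b0, 0 < b0 /\ forall t, b0 <= a t.
Proof.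
unfold inf_pos. intros H.
destruct (Glb_Rbar_correct (fun y => exists s, y = a s)) as [L _].
destruct (Glb_Rbar (fun y => exists s, y = a s)) as [l| |]; simpl in H.
- exists l. split; [exact H|]. intros t. apply (L (a t)). now exists t.
(* An infinite lower bound is absurd since the range is inhabited; the witness is arbitrary. *)
- exists 1. split; [lra|]. intros t. destruct (L (a t)). now exists t.
- contradiction.
Qed.

(** If no infimum outside a ball exceeded [l], then [l] would bound their supremum. *)
Lemma liminf_abs_bound (a : R -> R) (l : R) :
  Rbar_lt (Finite l) (liminf_abs a) ->
  exists beta r, l < beta /\ forall t, r <= Rabs t -> beta <= a t.
Proof.
intros H. apply NNPP. intros N.
assert (Rbar_le (liminf_abs a) (Finite l)); [|now apply (Rbar_lt_not_le (liminf_abs a) l)].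
unfold liminf_abs, Rbar_lub. destruct Rbar_ex_lub as [m [Hu Hm]]. simpl. apply Hm.
intros y [r ->]. apply Rbar_not_lt_le. intros Q. apply N.
unfold inf_outside in Q.
destruct (Glb_Rbar_correct (fun y => exists t, r <= Rabs t /\ y = a t)) as [L _].
revert Q L. generalize (Glb_Rbar (fun y => exists t, r <= Rabs t /\ y = a t)).
intros [i| |] Q L; simpl in Q.
- exists i, r. split; [exact Q|]. intros t Ht. apply (L (a t)). now exists t.
- exists (l + 1), r. split; [lra|]. intros t Ht. destruct (L (a t)). now exists t.
- contradiction.
Qed.

Lemma is_lim_abs_small (f : R -> R) (s : R) :
  0 < s -> is_lim f p_infty 0 -> is_lim f m_infty 0 ->
  exists T, forall t, T < Rabs t -> Rabs (f t) < s.
Proof.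
intros s0 Hp Hm. apply is_lim_spec in Hp, Hm.
destruct (Hp (mkposreal s s0)) as [S1 H1]. destruct (Hm (mkposreal s s0)) as [S2 H2].
exists (Rmax S1 (- S2)). intros t Ht.
pose proof (Rmax_l S1 (- S2)). pose proof (Rmax_r S1 (- S2)).
unfold Rabs in Ht. destruct Rcase_abs as [L|L].
- specialize (H2 t ltac:(lra)). simpl in H2. now rewrite Rminus_0_r in H2.
- specialize (H1 t ltac:(lra)). simpl in H1. now rewrite Rminus_0_r in H1.
Qed.

Lemma coercive_bound (a : R -> R) (B : R) :
  is_lim a p_infty p_infty -> is_lim a m_infty p_infty ->
  exists S, forall t, S <= Rabs t -> B <= a t.
Proof.
intros Hp Hm. apply is_lim_spec in Hp, Hm.
destruct (Hp B) as [S1 H1]. destruct (Hm B) as [S2 H2].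
exists (Rmax S1 (- S2) + 1). intros t Ht.
pose proof (Rmax_l S1 (- S2)). pose proof (Rmax_r S1 (- S2)).
unfold Rabs in Ht. destruct Rcase_abs as [L|L].
- specialize (H2 t ltac:(lra)). lra.
- specialize (H1 t ltac:(lra)). lra.
Qed.

Lemma continuous_scaled (a : R -> R) (eps : R) :
  (forall t, continuous a t) -> forall t, continuous (fun t => a (eps * t)) t.
Proof.
intros Ha t. apply (continuous_comp (fun t => eps * t) a); [|apply Ha].
apply (continuous_scal_r eps (fun t : R => t)), continuous_id.
Qed.

Lemma Rabs_scaled_ge (eps T t : R) : 0 < eps -> T / eps <= Rabs t -> T <= Rabs (eps * t).
Proof.
intros He Ht. rewrite Rabs_mult, (Rabs_right eps) by lra.
apply (Rmult_le_compat_l eps) in Ht; [|lra].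
replace (eps * (T / eps)) with T in Ht by (field; lra). exact Ht.
Qed.

Lemma Rabs_far (T L t u : R) : T + L <= Rabs t -> Rabs (u - t) <= L -> T <= Rabs u.
Proof.
intros Ht Hu. pose proof (Rabs_triang u (t - u)) as H.
replace (u + (t - u)) with t in H by ring. rewrite (Rabs_minus_sym t u) in H. lra.
Qed.

Theorem theorem1p1 (V a : R -> R) :
  C2 V ->
  (forall x, 0 <= V x) -> V (-1) = 0 -> V 1 = 0 ->
  (forall x, -1 < x < 1 -> 0 < V x) ->
  0 < Derive_n V 2 (-1) -> 0 < Derive_n V 2 1 ->
  (forall t, continuous a t) ->
  ((asymptotically_periodic a \/ coercive a) ->
     forall eps, 0 < eps ->
       exists x : R -> R, C2 x /\ solves_P V a eps x /\
         (forall t, -1 < x t < 1)) /\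
  ((exists M, forall t, Rabs (a t) <= M) ->
   Rbar_lt (Finite (a 0)) (liminf_abs a) ->
   (forall t, a 0 <= a t) -> 0 < a 0 ->
   exists eps_star, 0 < eps_star /\
     forall eps, 0 < eps < eps_star ->
       exists x : R -> R, C2 x /\ solves_P V a eps x /\
         (forall t, -1 < x t < 1)).
Proof.
intros VC V0 Vm V1 Vp _ _ Ha.
destruct (well_estimates V VC V0 Vm V1) as [K [K0 [Wl [Wq Wd]]]].
assert (Ww : forall rho q, rho = 1 \/ rho = -1 -> well V q <= K * (q - rho) ^ 2).
{ intros rho q Hr. specialize (Wq rho q ltac:(lra)).
  unfold dwell in Wq. unfold well in Wq at 2. rewrite clamp_id in Wq by lra.
  rewrite (dV_rest V VC V0 Vm V1 rho Hr) in Wq.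
  assert (V rho = 0) by (destruct Hr as [-> | ->]; assumption). lra. }
assert (W0 : forall p, 0 <= well V p) by (intros p; apply V0).
pose proof (heteroclinic_of_uniform_shift (well V) (dwell V) K K) as Shift.
specialize (fun b0 M => Shift b0 M (well_continuous V VC) W0 (well_pos V Vp) (well_clamp V) Ww
  (dwell_continuous V VC) K0 Wq K0 Wl (fun p => Wd 1 p (or_introl eq_refl))
  (fun p => Wd (-1) p (or_intror eq_refl))).
assert (Concl : forall eps, (exists x, heteroclinic (fun t => a (eps * t)) (dwell V) x) ->
  exists x : R -> R, C2 x /\ solves_P V a eps x /\ (forall t, -1 < x t < 1)).
{ intros eps [x Hx]. exists x. now apply heteroclinic_solves. }
split.
- intros [Hper|Hco] eps He; apply Concl.
  + destruct Hper as [aP [aPc [[P0 [P00 HP]] [Lp [Lm [Hinf Hlt]]]]]].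
    destruct (inf_pos_bound a Hinf) as [b0 [b00 Hb0]].
    set (P := P0 / eps). assert (PP : 0 < P) by (apply Rdiv_lt_0_compat; assumption).
    set (bP := fun t => aP (eps * t)).
    assert (HbP : forall t, bP (t + P) = bP t).
    { intros t. unfold bP.
      replace (eps * (t + P)) with (eps * t + P0) by (unfold P; field; lra). apply HP. }
    assert (bPc : forall t, continuous bP t) by now apply continuous_scaled.
    assert (bc : forall t, continuous (fun t => a (eps * t)) t) by now apply continuous_scaled.
    destruct (continuous_bounded_above bP 0 P bPc) as [M [M0 HM]].
    assert (HbM : forall t, bP t <= M).
    { intros t. destruct (period_reduction P t PP) as [z Hz].
      replace t with (t - IZR z * P + IZR z * P) by ring.
      rewrite (periodic_multiple bP P HbP). apply HM, Hz. }
    assert (Hgap : forall t, 0 < bP t - a (eps * t))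
      by (intros t; specialize (Hlt (eps * t)); unfold bP; lra).
    (* A period moves [t0] into [[0, P]], and the window after it has length [d <= 1]; so
       [[0, P + 1]] contains every translated window, and the gap is uniform there. *)
    destruct (continuity_ab_min (fun t => bP t - a (eps * t)) 0 (P + 1)) as [tm [Htm _]].
    { lra. }
    { intros t _. apply continuity_pt_filterlim.
      apply (continuous_minus bP (fun t => a (eps * t))); auto. }
    set (m1 := bP tm - a (eps * tm)) in *.
    assert (m10 : 0 < m1) by apply Hgap.
    assert (m20 : 0 < m1 / 2) by lra.
    destruct (Shift b0 M b00 ltac:(lra) (m1 / 2) m20) as [d [L [theta [d0 [L0 [th0 H]]]]]].
    assert (tb : 0 < theta * b0) by (apply Rmult_lt_0_compat; lra).
    (* The asymptotic error may use half of the gap on the window, and elsewhere stays below the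
       relative tolerance [theta]. *)
    set (s := Rmin (m1 / 2) (theta * b0)).
    assert (s0 : 0 < s) by (apply Rmin_pos; lra).
    assert (s1 : s <= m1 / 2) by apply Rmin_l.
    assert (s2 : s <= theta * b0) by apply Rmin_r.
    destruct (is_lim_abs_small _ s s0 Lp Lm) as [T HT].
    (* [L + 1] keeps the whole transition far out; the 1 added to [T] makes the inequality
       strict. *)
    apply (H _ ((T + 1) / eps + (L + 1))); [exact bc| |].
    { intros t. split; [apply Hb0|]. specialize (HbM t). specialize (Hgap t). lra. }
    intros t0 Ht0. destruct (period_reduction P t0 PP) as [z Hz].
    exists (IZR z * P).
    assert (Key : forall u, t0 - L - 1 <= u <= t0 + L + 1 ->
      bP (u - IZR z * P) <= a (eps * u) + s).
    { intros u Hu.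
      assert (Hut : Rabs (u - t0) <= L + 1) by (apply Rabs_le; lra).
      assert (Far : T + 1 <= Rabs (eps * u)).
      { apply Rabs_scaled_ge; [exact He|]. apply Rabs_far with (L + 1) t0; lra. }
      specialize (HT (eps * u) ltac:(lra)). rewrite Rabs_Rabsolu in HT.
      apply Rabs_def2 in HT.
      rewrite <- (periodic_multiple bP P HbP z (u - IZR z * P)).
      replace (u - IZR z * P + IZR z * P) with u by ring. unfold bP. lra. }
    split; intros u Hu.
    * specialize (Key u ltac:(lra)). specialize (Htm (u - IZR z * P) ltac:(lra)). lra.
    * specialize (Key u Hu). specialize (Hgap (u - IZR z * P)). specialize (Hb0 (eps * u)).
      assert (theta * b0 <= theta * a (eps * u)) by (apply Rmult_le_compat_l; lra). lra.
  + destruct Hco as [Hinf [Lp Lm]].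
    destruct (inf_pos_bound a Hinf) as [b0 [b00 Hb0]].
    apply (heteroclinic_of_coercive (fun t => a (eps * t)) (well V) (dwell V) b0 K K); auto.
    * now apply continuous_scaled.
    * now apply well_continuous.
    * now apply well_pos.
    * now apply well_clamp.
    * now apply dwell_continuous.
    * intros B. destruct (coercive_bound a B Lp Lm) as [S HS].
      exists (S / eps). intros t Ht. now apply HS, Rabs_scaled_ge.
- intros [M0 HM0] Hlim Hmin a00.
  destruct (liminf_abs_bound a (a 0) Hlim) as [beta [r [Hbeta Hr]]].
  (* Half of the gap is kept as the gain; the other half absorbs the variation of [a] near 0. *)
  set (m := (beta - a 0) / 2). assert (m0 : 0 < m) by (unfold m; lra).
  assert (HM : forall t, a t <= M0) by (intros t; specialize (HM0 t); apply Rabs_le_between in HM0; lra).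
  assert (M00 : 0 <= M0) by (specialize (HM 0); lra).
  destruct (Shift (a 0) M0 a00 M00 m m0) as [d [L [theta [d0 [L0 [th0 H]]]]]].
  destruct (proj1 (filterlim_locally _ _) (Ha 0) (mkposreal m m0)) as [rho Hrho].
  assert (rho0 : 0 < rho / (L + 1)) by (apply Rdiv_lt_0_compat; [apply rho|lra]).
  (* For such [eps], a transition of half-length [L + 1] translated to the origin only sees [a]
     within [rho] of 0, where [a] is below [a 0 + m]. *)
  exists (rho / (L + 1)). split; [exact rho0|]. intros eps [He1 He2]. apply Concl.
  assert (He : eps * (L + 1) < rho).
  { apply (Rmult_lt_compat_r (L + 1)) in He2; [|lra].
    replace (rho / (L + 1) * (L + 1)) with (pos rho) in He2 by (field; lra). exact He2. }
  apply (H _ (r / eps + (L + 1))); [now apply continuous_scaled|now split|].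
  intros t0 Ht0. exists t0.
  assert (Key : forall u, t0 - L - 1 <= u <= t0 + L + 1 ->
    a (eps * (u - t0)) <= a (eps * u) - m).
  { intros u Hu.
    assert (Hut : Rabs (u - t0) <= L + 1) by (apply Rabs_le; lra).
    assert (F : beta <= a (eps * u)).
    { apply Hr, Rabs_scaled_ge; [exact He1|]. apply Rabs_far with (L + 1) t0; lra. }
    assert (N : Rabs (a (eps * (u - t0)) - a 0) < m).
    { apply Hrho. change (Rabs (eps * (u - t0) - 0) < rho).
      rewrite Rminus_0_r, Rabs_mult, (Rabs_right eps) by lra.
      apply Rle_lt_trans with (2 := He). apply Rmult_le_compat_l; lra. }
    apply Rabs_def2 in N. unfold m in *. lra. }
  split; intros u Hu.
  + apply Key. lra.
  + specialize (Key u Hu). specialize (Hmin (eps * u)).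
    assert (0 <= theta * a (eps * u)) by (apply Rmult_le_pos; lra). lra.
Qed.
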